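(* For each $1\le j\le m$ let $(a_{f,j}(n))_{n\ge-n_0}$ be a sequence of complex numbers with $a_{f,j}(n)=O(e^{C\sqrt n})$ as $n\to\infty$ for some $C>0$. For $\tau\in\mathbb{H}$ set \[f(\tau):=\sum_{j=1}^m\sum_{n=-n_0}^\infty a_{f,j}(n)e^{2\pi i(n+\kappa_j)\tau}\mathbf{e}_j.\] Suppose that for each $\varphi\in S_c(\mathbb{R}_+)$, \[L_f(\varphi)=i^k\rho(S)\,L_f(\varphi|_{2-k,\chi^{-1}}S),\] where $(\varphi|_{2-k,\chi^{-1}}S)(x):=x^{k-2}\chi(S)\varphi(1/x)$ and $L_f(\varphi):=\sum_{j=1}^m\sum_{n\ge-n_0}a_{f,j}(n)(\mathcal{L}\varphi)(2\pi(n+\kappa_j))\mathbf{e}_j$ with $(\mathcal{L}\varphi)(s)=\int_0^\infty e^{-st}\varphi(t)dt$. Then $f\in M^!_{k,\chi,\rho}$.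
   Context: Let $\Gamma=\mathrm{SL}_2(\mathbb{Z})$, $T=\left(\begin{smallmatrix}1&1\\0&1\end{smallmatrix}\right)$, $S=\left(\begin{smallmatrix}0&-1\\1&0\end{smallmatrix}\right)$. Let $k\in\frac12\mathbb{Z}$, $\chi$ a unitary multiplier system of weight $k$ on $\Gamma$ ($|\chi|=1$ and $\chi(\gamma_1\gamma_2)(c_3\tau+d_3)^k=\chi(\gamma_1)\chi(\gamma_2)(c_1\gamma_2\tau+d_1)^k(c_2\tau+d_2)^k$, where $\gamma_1\gamma_2=\left(\begin{smallmatrix}a_3&b_3\\c_3&d_3\end{smallmatrix}\right)$), $m\ge1$, $\rho:\Gamma\to\mathrm{GL}(m,\mathbb{C})$ a unitary representation, $\mathbf{e}_j$ the standard basis of $\mathbb{C}^m$, and $(f|_{k,\chi,\rho}\gamma)(\tau):=(c\tau+d)^{-k}\chi(\gamma)^{-1}\rho(\gamma)^{-1}f(\gamma\tau)$. The numbers $\kappa_1,\dots,\kappa_m\in[0,1)$ are attached to $(\chi,\rho)$ via $\chi(T)\rho(T)\mathbf{e}_j=e^{2\pi i\kappa_j}\mathbf{e}_j$ for all $j$. $M^!_{k,\chi,\rho}$ is the space of holomorphic $f=\sum_jf_j\mathbf{e}_j$ on $\mathbb{H}$ with $f|_{k,\chi,\rho}\gamma=f$ for all $\gamma\in\Gamma$ and $f_j(\tau)=\sum_{n+\kappa_j\gg0}a_{f,j}(n)e^{2\pi i(n+\kappa_j)\tau}$. $S_c(\mathbb{R}_+)$ is a set of complex-valued, compactly supported, piecewise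 smooth functions on $\mathbb{R}_+=(0,\infty)$ such that for every $y>0$ there exists $\varphi\in S_c(\mathbb{R}_+)$ with $\varphi(y)\ne0$.
   Formalization: It is additionally assumed that S_c is stable under φ(x) ↦ xφ(x) and that a piecewise smooth φ takes at each break point the value of an adjacent smooth piece; without these, S_c can make the functional equation a tautology (e.g. φ(x)=ψ(log x)/x with ψ even, k=0) and the claim fails. *)

(* Defs.v *)
(* The complex numbers are R[i] for an arbitrary R : realType.
   R[i]^o is R[i] seen as a normed space over itself; this is where limits and
   complex derivatives of R[i]-valued functions are taken. *)
From HB Require Import structures.
From mathcomp Require Export all_boot all_order all_algebra.
From mathcomp Require Export all_classical all_reals all_analysis.
From mathcomp Require Export complex spectral.

Set Implicit Arguments.
Unset Strict Implicit.
Unset Printing Implicit Defensive.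

Export Order.TTheory GRing.Theory Num.Theory.
Export numFieldNormedType.Exports.

Local Open Scope classical_set_scope.
Local Open Scope ring_scope.
Local Open Scope complex_scope.

Definition cexp (R : realType) (z : R[i]) : R[i] :=
  (expR (complex.Re z))%:C * (cos (complex.Im z) +i* sin (complex.Im z)).

(* Principal argument, with values in ]-pi, pi] for z != 0. *)
Definition carg (R : realType) (z : R[i]) : R :=
  if 0 <= complex.Im z then acos (complex.Re z / Normc.normc z)
  else - acos (complex.Re z / Normc.normc z).

(* Principal branch of z ^ r, meaningful for z != 0. *)
Definition cpow (R : realType) (z : R[i]) (r : R) : R[i] :=
  (Normc.normc z `^ r)%:C * (cos (r * carg z) +i* sin (r * carg z)).

Definition half_plane (R : realType) : set R[i] := [set tau | 0 < complex.Im tau].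
Arguments half_plane : clear implicits.

Definition SL2Z : set 'M[int]_2 := [set g | \det g = 1].

Definition mx2 (a b c d : int) : 'M[int]_2 :=
  \matrix_(i < 2, j < 2)
    if i == 0 then (if j == 0 then a else b) else (if j == 0 then c else d).

Definition matT : 'M[int]_2 := mx2 1 1 0 1.
Definition matS : 'M[int]_2 := mx2 0 (-1) 1 0.

Definition autfactor (R : realType) (g : 'M[int]_2) (tau : R[i]) : R[i] :=
  (g 1 0)%:~R * tau + (g 1 1)%:~R.

Definition moebius (R : realType) (g : 'M[int]_2) (tau : R[i]) : R[i] :=
  ((g 0 0)%:~R * tau + (g 0 1)%:~R) / autfactor g tau.

Definition half_integer (R : realType) (k : R) : Prop :=
  exists l : int, k = l%:~R / 2.

Definition unitary_multiplier (R : realType) (k : R) (chi : 'M[int]_2 -> R[i]) : Prop :=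
  (forall g, SL2Z g -> `|chi g| = 1) /\
  (forall g1 g2 tau, SL2Z g1 -> SL2Z g2 -> half_plane R tau ->
    chi (g1 *m g2) * cpow (autfactor (g1 *m g2) tau) k =
    chi g1 * chi g2 * cpow (autfactor g1 (moebius g2 tau)) k
      * cpow (autfactor g2 tau) k).

Definition unitary_representation (R : realType) (m : nat)
    (rho : 'M[int]_2 -> 'M[R[i]]_m) : Prop :=
  (forall g, SL2Z g -> rho g \is unitarymx) /\
  (forall g1 g2, SL2Z g1 -> SL2Z g2 -> rho (g1 *m g2) = rho g1 *m rho g2).

Definition std_basis (R : realType) (m : nat) (j : 'I_m) : 'cV[R[i]]_m :=
  delta_mx j 0.

Definition exponents (R : realType) (m : nat) (chi : 'M[int]_2 -> R[i])
    (rho : 'M[int]_2 -> 'M[R[i]]_m) (kappa : 'I_m -> R) : Prop :=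
  forall j, 0 <= kappa j < 1 /\
    chi matT *: (rho matT *m std_basis R j) =
    cexp (2 * pi * kappa j)*i *: std_basis R j.

Definition slash (R : realType) (m : nat) (k : R) (chi : 'M[int]_2 -> R[i])
    (rho : 'M[int]_2 -> 'M[R[i]]_m) (f : R[i] -> 'cV[R[i]]_m) (g : 'M[int]_2) :
    R[i] -> 'cV[R[i]]_m :=
  fun tau => (cpow (autfactor g tau) (- k) * (chi g)^-1)
               *: (invmx (rho g) *m f (moebius g tau)).

(* The l-th term (l : nat) of a series over the integers n >= - n0 is the one
   of index n = l - n0. *)
Definition shifted_index (n0 : int) (l : nat) : int := l%:Z - n0.

Definition fourier_term (R : realType) (kap : R) (n0 : int) (a : int -> R[i])
    (tau : R[i]) : nat -> R[i]^o :=
  fun l => let n := shifted_index n0 l in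
    a n * cexp ((2 * pi * (n%:~R + kap))*i * tau).

Definition holomorphic_on (R : realType) (D : set R[i]) (h : R[i] -> R[i]) : Prop :=
  forall z, D z -> derivable (h : R[i]^o -> R[i]^o) z 1.

Definition weakly_holomorphic_forms (R : realType) (m : nat) (k : R)
    (chi : 'M[int]_2 -> R[i]) (rho : 'M[int]_2 -> 'M[R[i]]_m)
    (kappa : 'I_m -> R) : set (R[i] -> 'cV[R[i]]_m) :=
  [set f : R[i] -> 'cV[R[i]]_m |
    [/\ forall j, holomorphic_on (half_plane R) (fun tau => f tau j 0),
    forall g, SL2Z g -> forall tau, half_plane R tau ->
      slash k chi rho f g tau = f tau &
    forall j, exists (n0 : int) (a : int -> R[i]),
      forall tau, half_plane R tau ->
        series (fourier_term (kappa j) n0 a tau) @ \oo --> (f tau j 0 : R[i]^o)]].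

Definition smooth (R : realType) (g : R -> R[i]) : Prop :=
  forall (n : nat) (x : R),
    derivable (derive1n n (fun t => complex.Re (g t))) x 1 /\
    derivable (derive1n n (fun t => complex.Im (g t))) x 1.

(* ]0, +oo[ is covered by finitely many nondegenerate intervals on each of which
   phi is the restriction of a C^oo function. Jumps are allowed; the value at a
   break point is that of one of the two adjacent pieces. *)
Definition piecewise_smooth (R : realType) (phi : R -> R[i]) : Prop :=
  exists (N : nat) (I : 'I_N -> interval R) (g : 'I_N -> R -> R[i]),
    [/\ forall i, exists x y, [/\ x \in I i, y \in I i & x < y],
        forall i, smooth (g i),
        forall i x, x \in I i -> phi x = g i x &
        forall x, 0 < x -> exists i, x \in I i].

(* A function on ]0, +oo[ with compact support is represented by its extension
   by zero to R. *)
Definition compactly_supported (R : realType) (phi : R -> R[i]) : Prop :=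
  exists a b : R, 0 < a /\ forall x, ~~ (a <= x <= b) -> phi x = 0.

(* Any set of test functions stable under phi |-> phi(x) x^(s-1) for all complex
   s satisfies this (s = 2). Some such stability is needed in a converse theorem
   for a general set of test functions: if only "for all y > 0, some phi in Sc
   has phi y != 0" is asked, take k = 0, m = 1, chi = rho = 1, and for Sc all
   functions psi (ln x) / x with psi even, smooth and compactly supported. Then
   x^(-2) phi(1/x) = phi x on Sc, so the functional equation is a tautology,
   also for f = exp (2 pi i tau), which is not modular. *)
Definition stable_mulX (R : realType) (Sc : set (R -> R[i])) : Prop :=
  forall phi, Sc phi -> Sc (fun x => x%:C * phi x).

Definition cintegral (R : realType) (D : set R) (h : R -> R[i]) : R[i] :=
  (\int[@lebesgue_measure R]_(t in D) complex.Re (h t))%R +i*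
  (\int[@lebesgue_measure R]_(t in D) complex.Im (h t))%R.

Definition laplace (R : realType) (phi : R -> R[i]) (s : R) : R[i] :=
  cintegral `]0, +oo[ (fun t => (expR (- (s * t)))%:C * phi t).

Definition slashS (R : realType) (k : R) (chi : 'M[int]_2 -> R[i])
    (phi : R -> R[i]) : R -> R[i] :=
  fun x => (x `^ (k - 2))%:C * chi matS * phi x^-1.

Definition fourier_series (R : realType) (m : nat) (kappa : 'I_m -> R) (n0 : int)
    (a : 'I_m -> int -> R[i]) : R[i] -> 'cV[R[i]]_m :=
  fun tau => \sum_(j < m)
    (limn (series (fourier_term (kappa j) n0 (a j) tau)) : R[i]) *: std_basis R j.

Definition Lseries_term (R : realType) (kap : R) (n0 : int) (a : int -> R[i])
    (phi : R -> R[i]) : nat -> R[i]^o :=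
  fun l => let n := shifted_index n0 l in
    a n * laplace phi (2 * pi * (n%:~R + kap)).

Definition Lseries (R : realType) (m : nat) (kappa : 'I_m -> R) (n0 : int)
    (a : 'I_m -> int -> R[i]) (phi : R -> R[i]) : 'cV[R[i]]_m :=
  \sum_(j < m)
    (limn (series (Lseries_term (kappa j) n0 (a j) phi)) : R[i]) *: std_basis R j.

Definition subexp_growth (R : realType) (a : int -> R[i]) : Prop :=
  exists2 C : R, 0 < C &
    (fun n : nat => a n%:Z : R[i]^o) =O_\oo
    (fun n : nat => (expR (C * Num.sqrt n%:R))%:C : R[i]^o).

(* Main.v *)
Require Import Defs.
From mathcomp Require Import measurable_realfun.
From mathcomp Require Import ring lra zify.

(** Termwise integration turns the functional equation into an identity between
    integrals of phi against f(it) and against the S-transform of f(it).  The set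
    of test functions is stable under multiplication by x, so polynomial factors
    may be inserted.  The polynomials (1 - (x/(N y))^n)^(N^n) converge boundedly to
    the indicator function of x < y; hence the two integrals agree on every
    interval, and differentiating in the endpoint y gives the transformation law
    of f under S on the imaginary axis.  No change of variables is needed.

    To leave the axis, write tau = exp w with 0 < Im w < pi.  The defect of the
    transformation law is holomorphic in w and vanishes on the line Im w = pi/2.
    On a rectangle with one side on that line, the maximum principle applied to
    the defect times exp (N phi), phi quadratic, shows as N tends to infinity that
    it vanishes.  Holomorphy is used only through second order Taylor expansions
    with a cubic remainder, which exp and Fourier series satisfy and which are
    stable under sums, products and composition.

    The law under T is the definition of the exponents kappa, and S and T
    generate SL_2(Z). *)

Set Implicit Arguments.
Unset Strict Implicit.
Unset Printing Implicit Defensive.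

Local Open Scope classical_set_scope.
Local Open Scope ring_scope.
Local Open Scope complex_scope.

Local Notation nc := Normc.normc.

(** * Complex modulus and exponential *)

Section ComplexModulus.
Variable R : realType.
Implicit Types z w : R[i].

(** Multiplying [phi] by x^j multiplies its S-transform by x^(-j). The functional equation thus
    equates moments in t on one side with moments in 1/t on the other, and inversion only ever has
    to act on intervals. A short interval at y of length s is inverted to one of length about s/y^2;
    this y^(-2) and the factor (1/y)^(k-2) of the S-transform make up the weight y^(-k). The test
    function only localises: it is divided out at y, where it is nonzero, and since it may jump
    there, limits at y are taken from one side.

    The coordinate w = log tau suits S: the imaginary axis becomes a line, tau^k becomes the entire
    function exp (k w), and no branch cut is met. Order 2 with a cubic remainder is what the maximum
    principle needs: it compares a centre with four points at distance t, a small multiple e of a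
    squared distance gives a gain e t^2, and this outweighs an error of order t^3 but would not
    outweigh one of order t^2. *)

Lemma normc_ge0 z : 0 <= nc z.
Proof. by case: z => a b; exact: sqrtr_ge0. Qed.

Lemma normcD z w : nc (z + w) <= nc z + nc w.
Proof. exact: le_normcD. Qed.

Lemma normcB z w : nc (z - w) <= nc z + nc w.
Proof. by rewrite (le_trans (normcD _ _))// normcN. Qed.

Lemma normcX z n : nc (z ^+ n) = nc z ^+ n.
Proof.
elim: n => [|n ih]; first by rewrite !expr0 -(@Normc.normc1 R).
by rewrite !exprS Normc.normcM ih.
Qed.

Lemma normc_sqr z : nc z ^+ 2 = complex.Re z ^+ 2 + complex.Im z ^+ 2.
Proof. by case: z => a b; rewrite /= sqr_sqrtr// addr_ge0// sqr_ge0. Qed.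

Lemma normc_real (x : R) : nc x%:C = `|x|.
Proof. by rewrite /= expr0n addr0 sqrtr_sqr. Qed.

Lemma norm_Re_le z : `|complex.Re z| <= nc z.
Proof.
rewrite -ler_sqr ?nnegrE ?normc_ge0 ?normr_ge0// normc_sqr real_normK ?num_real//.
by rewrite lerDl sqr_ge0.
Qed.

Lemma norm_Im_le z : `|complex.Im z| <= nc z.
Proof.
rewrite -ler_sqr ?nnegrE ?normc_ge0 ?normr_ge0// normc_sqr real_normK ?num_real//.
by rewrite lerDr sqr_ge0.
Qed.

Lemma normc_le_ReIm z : nc z <= `|complex.Re z| + `|complex.Im z|.
Proof.
rewrite -ler_sqr ?nnegrE ?normc_ge0 ?addr_ge0 ?normr_ge0// normc_sqr.
have : 0 <= `|complex.Re z| * `|complex.Im z| by rewrite mulr_ge0.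
rewrite -(real_normK (num_real (complex.Re z))) -(real_normK (num_real (complex.Im z))).
by nra.
Qed.

Lemma normc_eq0 z : (nc z == 0) = (z == 0).
Proof.
apply/eqP/eqP => [/Normc.eq0_normc//|->]; exact: Normc.normc0.
Qed.

Lemma normc_gt0 z : (0 < nc z) = (z != 0).
Proof. by rewrite lt_def normc_eq0 normc_ge0 andbT. Qed.

Lemma normc_sum (I : Type) (r : seq I) (P : pred I) (F : I -> R[i]) :
  nc (\sum_(i <- r | P i) F i) <= \sum_(i <- r | P i) nc (F i).
Proof.
elim/big_ind2 : _ => //; first by rewrite Normc.normc0.
by move=> x1 x2 y1 y2 h1 h2; rewrite (le_trans (normcD _ _))// lerD.
Qed.

Lemma ReM z w : complex.Re (z * w) =
  complex.Re z * complex.Re w - complex.Im z * complex.Im w.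
Proof. by case: z => a b; case: w => c d. Qed.

Lemma ImM z w : complex.Im (z * w) =
  complex.Re z * complex.Im w + complex.Im z * complex.Re w.
Proof. by case: z => a b; case: w => c d. Qed.

Lemma ReD z w : complex.Re (z + w) = complex.Re z + complex.Re w.
Proof. by case: z => a b; case: w => c d. Qed.

Lemma ImD z w : complex.Im (z + w) = complex.Im z + complex.Im w.
Proof. by case: z => a b; case: w => c d. Qed.

Lemma ReN z : complex.Re (- z) = - complex.Re z.
Proof. by case: z => a b. Qed.

Lemma ImN z : complex.Im (- z) = - complex.Im z.
Proof. by case: z => a b. Qed.

Lemma Re_sum (I : Type) (r : seq I) (P : pred I) (F : I -> R[i]) :
  complex.Re (\sum_(i <- r | P i) F i) = \sum_(i <- r | P i) complex.Re (F i).
Proof. exact: (big_morph _ ReD). Qed.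

Lemma Im_sum (I : Type) (r : seq I) (P : pred I) (F : I -> R[i]) :
  complex.Im (\sum_(i <- r | P i) F i) = \sum_(i <- r | P i) complex.Im (F i).
Proof. exact: (big_morph _ ImD). Qed.

Lemma complex_ext z w : complex.Re z = complex.Re w ->
  complex.Im z = complex.Im w -> z = w.
Proof. by case: z => a b; case: w => c d /= -> ->. Qed.

Lemma Re_real (x : R) : complex.Re x%:C = x. Proof. by []. Qed.
Lemma Im_real (x : R) : complex.Im x%:C = 0. Proof. by []. Qed.

Lemma Re_mk (x y : R) : complex.Re (x +i* y) = x. Proof. by []. Qed.
Lemma Im_mk (x y : R) : complex.Im (x +i* y) = y. Proof. by []. Qed.

End ComplexModulus.

Definition ReImE :=
  (ReM, ImM, ReD, ImD, ReN, ImN, Re_real, Im_real, Re_mk, Im_mk).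

Section ComplexExponential.
Variable R : realType.
Implicit Types z w : R[i].

Lemma cexpD z w : cexp (z + w) = cexp z * cexp w.
Proof.
by apply: complex_ext; rewrite /cexp !ReImE/= expRD cosD sinD; ring.
Qed.

Lemma cexp0 : cexp 0 = 1 :> R[i].
Proof. by apply: complex_ext; rewrite /cexp /= expR0 cos0 sin0; ring. Qed.

Lemma normc_cexp z : nc (cexp z) = expR (complex.Re z).
Proof.
apply/eqP; rewrite -(@eqrXn2 _ 2) ?normc_ge0 ?expR_ge0//; apply/eqP.
rewrite normc_sqr /cexp !ReImE/=.
transitivity (expR (complex.Re z) ^+ 2 * (cos (complex.Im z) ^+ 2 + sin (complex.Im z) ^+ 2)).
  by ring.
by rewrite cos2Dsin2 mulr1.
Qed.

Lemma cexp_neq0 z : cexp z != 0.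
Proof. by rewrite -normc_gt0 normc_cexp expR_gt0. Qed.

Lemma cexpN z : cexp (- z) = (cexp z)^-1.
Proof.
by apply: (mulfI (cexp_neq0 z)); rewrite divff ?cexp_neq0// -cexpD subrr cexp0.
Qed.

Lemma mean_value_bound (h h' : R -> R) (M : R) :
  (forall t : R, is_derive t 1 h (h' t)) -> h 0 = 0 ->
  (forall t, 0 <= t <= 1 -> `|h' t| <= M) ->
  forall t, 0 <= t <= 1 -> `|h t| <= M.
Proof.
move=> dh h0 hM t /andP[t0 t1].
have M0 : 0 <= M by rewrite (le_trans _ (hM 0 _))// lexx ler01.
have ch : {within `[0, t], continuous h}.
  apply: continuous_subspaceT => x.
  by apply: differentiable_continuous; apply/derivable1_diffP; have [] := dh x.
have [c ct E] := MVT_segment t0 (fun x _ => dh x) ch.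
move: E; rewrite h0 !subr0 => ->; move: ct; rewrite in_itv/= => /andP[c0 ct].
rewrite normrM (ger0_norm t0) -[leRHS]mulr1 ler_pM//.
by rewrite hM// c0 (le_trans ct).
Qed.

(** Componentwise, so that the real mean value theorem applies to each coordinate. *)
Definition path_derive (h : R -> R[i]) (t : R) (v : R[i]) : Prop :=
  is_derive t 1 (fun x => complex.Re (h x)) (complex.Re v) /\
  is_derive t 1 (fun x => complex.Im (h x)) (complex.Im v).

Lemma path_deriveB h1 h2 t v1 v2 : path_derive h1 t v1 -> path_derive h2 t v2 ->
  path_derive (fun x => h1 x - h2 x) t (v1 - v2).
Proof.
move=> [r1 i1] [r2 i2]; split.
  under eq_fun do rewrite !ReImE.
  rewrite !ReImE; exact: is_deriveB.
under eq_fun do rewrite !ReImE.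
rewrite !ReImE; exact: is_deriveB.
Qed.

Lemma path_derive_cst c t : path_derive (fun=> c) t 0.
Proof. by split; exact: is_derive_cst. Qed.

Lemma path_derive_real (g : R -> R) (g' : R) c (t : R) : is_derive t 1 g g' ->
  path_derive (fun x => (g x)%:C * c) t (g'%:C * c).
Proof.
move=> dg; split.
  under eq_fun do rewrite !ReImE mul0r subr0 mulrC.
  by rewrite !ReImE mul0r subr0 mulrC; exact: is_deriveZ.
under eq_fun do rewrite !ReImE mul0r addr0 mulrC.
by rewrite !ReImE mul0r addr0 mulrC; exact: is_deriveZ.
Qed.

(** The mean value theorem fails for complex-valued paths; it is applied to the real and imaginary
    parts separately, at the price of the factor 2. *)
Lemma path_mean_value_bound (h h' : R -> R[i]) (M : R) :
  (forall t : R, path_derive h t (h' t)) ->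
  h 0 = 0 -> (forall t, 0 <= t <= 1 -> nc (h' t) <= M) ->
  forall t, 0 <= t <= 1 -> nc (h t) <= 2 * M.
Proof.
move=> d h0 hM t ht; rewrite (le_trans (normc_le_ReIm _))// mulr2n mulrDl mul1r lerD//.
  apply: (mean_value_bound (fun t => (d t).1)) => //; first by rewrite h0.
  by move=> s hs; rewrite (le_trans (norm_Re_le _))// hM.
apply: (mean_value_bound (fun t => (d t).2)) => //; first by rewrite h0.
by move=> s hs; rewrite (le_trans (norm_Im_le _))// hM.
Qed.

Lemma is_derive_Re_cexp z (t : R) :
  is_derive t 1 (fun x : R => complex.Re (cexp (x%:C * z))) (complex.Re (z * cexp (t%:C * z))).
Proof.
have -> : (fun x : R => complex.Re (cexp (x%:C * z))) =
    (fun x : R => expR (x * complex.Re z) * cos (x * complex.Im z)).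
  by apply/funext => x; rewrite /cexp !ReImE/= !mul0r !subr0 !addr0; ring.
apply: is_derive_eq; rewrite /cexp !ReImE /GRing.scale/= !mul0r !subr0 !addr0; ring.
Qed.

Lemma is_derive_Im_cexp z (t : R) :
  is_derive t 1 (fun x : R => complex.Im (cexp (x%:C * z))) (complex.Im (z * cexp (t%:C * z))).
Proof.
have -> : (fun x : R => complex.Im (cexp (x%:C * z))) =
    (fun x : R => expR (x * complex.Re z) * sin (x * complex.Im z)).
  by apply/funext => x; rewrite /cexp !ReImE/= !mul0r !subr0 !addr0; ring.
apply: is_derive_eq; rewrite /cexp !ReImE /GRing.scale/= !mul0r !subr0 !addr0; ring.
Qed.

Lemma path_derive_cexp z (t : R) :
  path_derive (fun x => cexp (x%:C * z)) t (z * cexp (t%:C * z)).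
Proof. by split; [exact: is_derive_Re_cexp | exact: is_derive_Im_cexp]. Qed.

(* The mean value bound along the segment [0, z], once for each order. *)
Lemma cexp_taylor2 z :
  nc (cexp z - 1 - z - z ^+ 2 / 2) <= 8 * nc z ^+ 3 * expR (nc z).
Proof.
set M := expR (nc z).
have d0 := path_derive_cexp z.
have e0 t : 0 <= t <= 1 -> nc (z * cexp (t%:C * z)) <= nc z * M.
  move=> /andP[t0 t1]; rewrite Normc.normcM ler_wpM2l ?normc_ge0// normc_cexp ler_expR.
  rewrite (le_trans (ler_norm _))// (le_trans (norm_Re_le _))// Normc.normcM normc_real.
  by rewrite ger0_norm// ler_piMl// normc_ge0.
have d1 t := path_deriveB (d0 t) (path_derive_cst 1 t).
have e1 := @path_mean_value_bound _ (fun t => z * cexp (t%:C * z)) (nc z * M).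
have {}e1 t : 0 <= t <= 1 -> nc (cexp (t%:C * z) - 1) <= 2 * (nc z * M).
  move: t; apply: (e1 (fun x : R => cexp (x%:C * z) - 1)) => //; last by rewrite mul0r cexp0 subrr.
  by move=> t; have := d1 t; rewrite subr0.
have d2 t := path_deriveB (d1 t) (path_derive_real z (is_derive_id t 1)).
have e2 := @path_mean_value_bound _ (fun t => z * (cexp (t%:C * z) - 1))
  (nc z * (2 * (nc z * M))).
have {}e2 t : 0 <= t <= 1 -> nc (cexp (t%:C * z) - 1 - t%:C * z) <=
   2 * (nc z * (2 * (nc z * M))).
  move: t; apply: (e2 (fun x : R => cexp (x%:C * z) - 1 - x%:C * z)) => //.
  - by move=> t; have := d2 t; rewrite subr0 mulrBr mulr1 mul1r.
  - by rewrite mul0r cexp0 !subrr.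
  - by move=> t ht; rewrite Normc.normcM ler_wpM2l ?normc_ge0// e1.
have dX (t : R) : is_derive t 1 (fun x : R => x ^+ 2) (2 * t).
  apply: is_derive_eq; rewrite /GRing.scale/= ?mulr1; ring.
have d3 t := path_deriveB (d2 t) (path_derive_real (z ^+ 2 / 2) (dX t)).
have e3 := @path_mean_value_bound _ (fun t => z * (cexp (t%:C * z) - 1 - t%:C * z))
  (nc z * (2 * (nc z * (2 * (nc z * M))))).
(* Three successive mean value bounds, each costing a factor 2|z|, give 8|z|^3 [M]. *)
have {e3} : nc (cexp (1%:C * z) - 1 - 1%:C * z - (1 ^+ 2)%:C * (z ^+ 2 / 2)) <=
    2 * (nc z * (2 * (nc z * (2 * (nc z * M))))).
  apply: (e3 (fun x : R => cexp (x%:C * z) - 1 - x%:C * z - (x ^+ 2)%:C * (z ^+ 2 / 2))).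
  - move=> t; have := d3 t; congr path_derive.
    by rewrite subr0 mul1r rmorphM/= rmorphMn/= rmorph1; field.
  - by rewrite expr0n !mul0r cexp0 !subrr.
  - by move=> t ht; rewrite Normc.normcM ler_wpM2l ?normc_ge0// e2.
  - by rewrite ler01 lexx.
rewrite expr1n rmorph1 !mul1r => /le_trans; apply.
by rewrite le_eqVlt; apply/orP; left; apply/eqP; ring.
Qed.

End ComplexExponential.

(** * Second order Taylor expansions *)

Section TwoJets.
Variable R : realType.
Implicit Types (F G : R[i] -> R[i]) (p q h : R[i]).

(** A condition at the single point [p], with [A] and [B] in the roles of F'(p) and F''(p)/2. The
    bound r <= 1 lets higher powers of |h| be absorbed into lower ones. *)
Definition jet2 F p : Prop := exists (A B : R[i]) (K r : R),
  [/\ 0 <= K, 0 < r <= 1 & forall h, nc h < r ->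
    nc (F (p + h) - F p - A * h - B * h ^+ 2) <= K * nc h ^+ 3].

Lemma jet2_near F G p (K r : R) : jet2 G p -> F p = G p -> 0 < r ->
  (forall h, nc h < r -> nc (F (p + h) - G (p + h)) <= K * nc h ^+ 3) ->
  jet2 F p.
Proof.
move=> [A [B [K' [r' [K0 /andP[r0 r1] H]]]]] e s0 HK.
exists A, B, (K' + `|K|), (Num.min r r'); split.
- by rewrite addr_ge0.
- by rewrite lt_min s0 r0/= ge_min r1 orbT.
move=> h; rewrite lt_min => /andP[h1 h2].
have -> : F (p + h) - F p - A * h - B * h ^+ 2 =
  (G (p + h) - G p - A * h - B * h ^+ 2) + (F (p + h) - G (p + h)).
  by rewrite e; ring.
rewrite (le_trans (normcD _ _))// [leRHS]mulrDl lerD ?H//.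
by rewrite (le_trans (HK _ h1))// ler_wpM2r ?exprn_ge0 ?normc_ge0// ler_norm.
Qed.

Lemma jet2_cst (c : R[i]) p : jet2 (fun=> c) p.
Proof.
exists 0, 0, 0, 1; split => //; first by rewrite ltr01 lexx.
by move=> h _; rewrite !mul0r !subr0 subrr Normc.normc0.
Qed.

Lemma jet2_id p : jet2 id p.
Proof.
exists 1, 0, 0, 1; split => //; first by rewrite ltr01 lexx.
move=> h _; have -> : p + h - p - 1 * h - 0 * h ^+ 2 = 0 by ring.
by rewrite mul0r Normc.normc0.
Qed.

Lemma jet2D F G p : jet2 F p -> jet2 G p -> jet2 (fun z => F z + G z) p.
Proof.
move=> [A [B [K [r [K0 /andP[r0 r1] H]]]]] [A' [B' [K' [r' [K0' /andP[r0' r1'] H']]]]].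
exists (A + A'), (B + B'), (K + K'), (Num.min r r'); split.
- by rewrite addr_ge0.
- by rewrite lt_min r0 r0'/= ge_min r1.
move=> h; rewrite lt_min => /andP[h1 h2].
have -> : F (p + h) + G (p + h) - (F p + G p) - (A + A') * h - (B + B') * h ^+ 2 =
  (F (p + h) - F p - A * h - B * h ^+ 2) + (G (p + h) - G p - A' * h - B' * h ^+ 2).
  by ring.
by rewrite (le_trans (normcD _ _))// [leRHS]mulrDl lerD ?H ?H'.
Qed.

Lemma normc_poly2 (a b c h : R[i]) : nc h <= 1 ->
  nc (a + b * h + c * h ^+ 2) <= nc a + nc b + nc c.
Proof.
move=> h1; rewrite (le_trans (normcD _ _))// lerD//; last first.
  by rewrite Normc.normcM normcX ler_piMr ?normc_ge0// exprn_ile1// normc_ge0.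
by rewrite (le_trans (normcD _ _))// lerD// Normc.normcM ler_piMr ?normc_ge0.
Qed.

Lemma jet2_bounded F p : jet2 F p -> exists M r : R,
  [/\ 0 <= M, 0 < r <= 1 & forall h, nc h < r -> nc (F (p + h)) <= M].
Proof.
move=> [A [B [K [r [K0 /andP[r0 r1] H]]]]].
exists (nc (F p) + nc A + nc B + K), r; split; last 2 first.
- by rewrite r0.
- move=> h hr; have h1 : nc h <= 1 by rewrite (le_trans (ltW hr)).
  have -> : F (p + h) = (F p + A * h + B * h ^+ 2) +
    (F (p + h) - F p - A * h - B * h ^+ 2) by ring.
  rewrite (le_trans (normcD _ _))// lerD ?normc_poly2// (le_trans (H _ hr))//.
  by rewrite ler_piMr// exprn_ile1// normc_ge0.
by rewrite !addr_ge0 ?normc_ge0.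
Qed.

Lemma jet2M F G p : jet2 F p -> jet2 G p -> jet2 (fun z => F z * G z) p.
Proof.
move=> [A [B [K [r [K0 /andP[r0 r1] H]]]]] jG.
have [M [s [M0 /andP[s0 s1] HM]]] := jet2_bounded jG.
move: jG => [A' [B' [K' [r' [K0' /andP[r0' r1'] H']]]]].
pose L := nc (F p) + nc A + nc B.
have L0 : 0 <= L by rewrite !addr_ge0 ?normc_ge0.
exists (F p * A' + A * G p), (F p * B' + A * A' + B * G p),
  (K * M + L * K' + (nc (A * B' + B * A') + nc (B * B'))), (Num.min r (Num.min s r')); split.
- by rewrite !addr_ge0 ?mulr_ge0 ?normc_ge0.
- by rewrite !lt_min r0 s0 r0'/= ge_min r1.
move=> h; rewrite !lt_min => /and3P[h1 h2 h3].
have hle : nc h <= 1 by rewrite (le_trans (ltW h1)).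
(* With P and Q the quadratic parts, FG - PQ = (F - P) G + P (G - Q); the last summand is the part
   of PQ of degrees 3 and 4. *)
have -> : F (p + h) * G (p + h) - F p * G p - (F p * A' + A * G p) * h -
   (F p * B' + A * A' + B * G p) * h ^+ 2 =
   (F (p + h) - F p - A * h - B * h ^+ 2) * G (p + h)
   + (F p + A * h + B * h ^+ 2) * (G (p + h) - G p - A' * h - B' * h ^+ 2)
   + (A * B' + B * A' + (B * B') * h) * h ^+ 3 by ring.
rewrite (le_trans (normcD _ _))// [leRHS]mulrDl lerD//; last first.
  rewrite Normc.normcM normcX ler_wpM2r ?exprn_ge0 ?normc_ge0//.
  by rewrite (le_trans (normcD _ _))// lerD// (Normc.normcM _ h) ler_piMr ?normc_ge0.
rewrite (le_trans (normcD _ _))// [leRHS]mulrDl lerD//.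
  by rewrite Normc.normcM mulrAC ler_pM ?normc_ge0 ?H ?HM.
by rewrite Normc.normcM -mulrA ler_pM ?normc_ge0 ?H' ?normc_poly2.
Qed.

Lemma jet2_lipschitz F p : jet2 F p -> exists L r : R,
  [/\ 0 < L, 0 < r <= 1 & forall h, nc h < r -> nc (F (p + h) - F p) <= L * nc h].
Proof.
move=> [A [B [K [r [K0 /andP[r0 r1] H]]]]].
exists (1 + nc A + nc B + K), r; split; last 2 first.
- by rewrite r0.
- move=> h hr; have h1 : nc h <= 1 by rewrite (le_trans (ltW hr)).
  have -> : F (p + h) - F p = (A + B * h) * h +
    (F (p + h) - F p - A * h - B * h ^+ 2) by ring.
  rewrite (le_trans (normcD _ _))// [leRHS]mulrDl lerD//.
    rewrite Normc.normcM ler_wpM2r ?normc_ge0// (le_trans (normcD _ _))//.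
    rewrite -addrA ler_wpDl// lerD// Normc.normcM ler_piMr// ?normc_ge0//.
  rewrite (le_trans (H _ hr))// ler_wpM2l// exprS ler_piMr ?normc_ge0//.
  by rewrite exprn_ile1// normc_ge0.
by rewrite -!addrA ltr_wpDr// !addr_ge0 ?normc_ge0.
Qed.

(** To third order the composite is the quadratic polynomial of [F] in the increment [U] of [G],
    which has a jet by closure under sums and products. Since |U| <= L|h|, the remainder of [F] is
    at most K L^3 |h|^3. *)
Lemma jet2_comp F G p : jet2 G p -> jet2 F (G p) -> jet2 (fun z => F (G z)) p.
Proof.
move=> jG [A [B [K [r [K0 /andP[r0 r1] H]]]]].
have [L [s [L0 /andP[s0 s1] HL]]] := jet2_lipschitz jG.
pose U z := G z + - G p.
have jU : jet2 U p by apply: jet2D => //; exact: jet2_cst.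
apply: (@jet2_near _ (fun z => F (G p) + (A * U z + B * (U z * U z))) p (K * L ^+ 3)
  (Num.min s (r / L))).
- apply: jet2D; first exact: jet2_cst.
  by apply: jet2D; apply: jet2M; rewrite ?jet2_cst//; [exact: jet2_cst|exact: jet2_cst|exact: jet2M].
- by rewrite /U subrr !mulr0 !addr0.
- by rewrite lt_min s0 divr_gt0.
move=> h; rewrite lt_min => /andP[hs hr].
have uL : nc (U (p + h)) <= L * nc h by rewrite HL.
have ur : nc (U (p + h)) < r by rewrite (le_lt_trans uL)// mulrC -ltr_pdivlMr.
have -> : G (p + h) = G p + U (p + h) by rewrite /U; ring.
set u := U _ in uL ur *.
have -> : F (G p + u) - (F (G p) + (A * u + B * (u * u))) =
  F (G p + u) - F (G p) - A * u - B * u ^+ 2 by ring.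
rewrite (le_trans (H _ ur))// -mulrA ler_wpM2l// -exprMn.
by rewrite lerXn2r ?nnegrE ?normc_ge0// mulr_ge0 ?normc_ge0// ltW.
Qed.

Lemma jet2_cexp p : jet2 (@cexp R) p.
Proof.
exists (cexp p), (cexp p / 2), (8 * expR (complex.Re p) * expR 1), 1; split.
- by rewrite !mulr_ge0// expR_ge0.
- by rewrite ltr01 lexx.
move=> h h1; rewrite cexpD.
have -> : cexp p * cexp h - cexp p - cexp p * h - cexp p / 2 * h ^+ 2 =
  cexp p * (cexp h - 1 - h - h ^+ 2 / 2) by ring.
rewrite Normc.normcM normc_cexp.
have := cexp_taylor2 h; move: (nc _) => T hT.
have e1 : expR (nc h) <= expR 1 by rewrite ler_expR ltW.
have {hT} : T <= 8 * nc h ^+ 3 * expR 1.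
  by rewrite (le_trans hT)// ler_wpM2l// mulr_ge0// exprn_ge0// normc_ge0.
move=> hT; rewrite (le_trans (ler_wpM2l (expR_ge0 _) hT))//.
by rewrite le_eqVlt; apply/orP; left; apply/eqP; ring.
Qed.

Lemma jet2_sum (I : Type) (s : seq I) (F : I -> R[i] -> R[i]) p :
  (forall i, jet2 (F i) p) -> jet2 (fun z => \sum_(i <- s) F i z) p.
Proof.
move=> jF; elim: s => [|i s ih].
  by under eq_fun do rewrite big_nil; exact: jet2_cst.
by under eq_fun do rewrite big_cons; exact: jet2D.
Qed.

(** The difference quotient differs from [A] by at most (|B| + K)|h|, which dictates [d]; the added
    1 keeps its denominator positive. *)
Lemma jet2_derivable F p : jet2 F p -> derivable (F : R[i]^o -> R[i]^o) p 1.
Proof.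
move=> [A [B [K [r [K0 /andP[r0 r1] H]]]]].
apply/cvg_ex; exists (A : R[i]^o).
apply/cvgrPdist_lt => e e0.
(* The norm of [R[i]] is [R[i]]-valued, and a positive element of [R[i]] is a positive real. *)
have er : 0 < complex.Re e by move: e0; rewrite ltcE/= => /andP[].
have eE : e = (complex.Re e)%:C.
  by move: e0; rewrite ltcE/= => /andP[/eqP ei _]; case: e ei {er} => a b /= ->.
pose d := Num.min r (complex.Re e / (nc B + K + 1)).
have D0 : 0 < nc B + K + 1 by rewrite ltr_wpDl// addr_ge0// normc_ge0.
have d0 : 0 < d by rewrite lt_min r0 divr_gt0.
near=> h.
have hn0 : h != 0 by near: h; exact: nbhs_dnbhs_neq.
have hd : nc h < d.
  rewrite -ltcR.
  near: h; apply: dnbhs0_lt; rewrite -[X in X < _]/(0%:C) ltcR//.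
move: hd; rewrite lt_min => /andP[hr hK].
have h1 : nc h <= 1 by rewrite (le_trans (ltW hr)).
rewrite /GRing.scale/= mulr1 eE.
rewrite -[X in X < _]/((nc (A - h^-1 * (F (h + p) - F p)))%:C) ltcR.
have -> : A - h^-1 * (F (h + p) - F p) =
  - (h^-1 * ((F (p + h) - F p - A * h - B * h ^+ 2) + B * h ^+ 2)).
  by rewrite (addrC h p); field.
rewrite normcN Normc.normcM Normc.normcV.
have hp : 0 < nc h by rewrite normc_gt0.
rewrite mulrC ltr_pdivrMr//.
apply: (@le_lt_trans _ _ ((nc B + K) * nc h * nc h)); last first.
  rewrite ltr_pM2r//.
  move: hK; rewrite ltr_pdivlMr// mulrC; apply: le_lt_trans.
  by rewrite ler_wpM2r ?normc_ge0// lerDl.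
rewrite (le_trans (normcD _ _))// addrC !mulrDl lerD//.
  by rewrite Normc.normcM normcX -mulrA expr2.
rewrite (le_trans (H _ hr))// -mulrA ler_wpM2l//.
rewrite exprS expr2 ler_piMl// mulr_ge0// normc_ge0//.
Unshelve. all: by end_near.
Qed.

End TwoJets.

(** * Maximum principle and the identity theorem on a strip *)

Section MaximumPrinciple.
Variable R : realType.
Implicit Types (F G : R[i] -> R[i]) (p q h z : R[i]).

(** If |E| <= |P|, square |P| - |E| <= |P + E|; otherwise the left side is at most |P|^2 - 2|P||E|
    <= 0. *)
Lemma normc_sqrD_ge (P E : R[i]) (M K : R) : nc P <= M -> nc E <= K ->
  nc P ^+ 2 - 2 * M * K <= nc (P + E) ^+ 2.
Proof.
move=> hM hK; have P0 := normc_ge0 P; have E0 := normc_ge0 E.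
have S0 := normc_ge0 (P + E).
have h : nc P <= nc (P + E) + nc E by rewrite -[X in nc X <= _](addrK E) normcB.
have PE : nc P * nc E <= M * K by rewrite ler_pM.
move: (nc P) (nc E) (nc (P + E)) h PE P0 E0 S0 => a b c h PE a0 b0 c0.
have [ab|ab] := leP b a; last by nra.
have : (a - b) ^+ 2 <= c ^+ 2 by rewrite lerXn2r ?nnegrE; lra.
by nra.
Qed.

(* Averaging over the four points p + t, p - t, p + it, p - it kills the terms
   of degree 1 and 2 of F, so that |F|^2 is subharmonic up to O(t^3). *)
Lemma jet2_no_strict_max F p z (e r : R) : 0 < e -> 0 < r -> jet2 F p ->
  (forall h, nc h < r ->
    nc (F (p + h)) ^+ 2 + e * nc (p + h - z) ^+ 2 <= nc (F p) ^+ 2 + e * nc (p - z) ^+ 2) ->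
  False.
Proof.
move=> e0 r0 [A [B [K [r' [K0 /andP[r0' r1'] H]]]]] Hmax.
pose M := nc (F p) + nc A + nc B.
have M0 : 0 <= M by rewrite !addr_ge0 ?normc_ge0.
have MK0 : 0 <= M * K by rewrite mulr_ge0.
(* The last bound makes 2MK t^3 < e t^2: the average cubic loss is smaller than the average gain
   from e|p + h - z|^2. *)
pose t := Num.min (r / 2) (Num.min (r' / 2) (e / (2 * (M * K) + 1))).
have D0 : 0 < 2 * (M * K) + 1 by lra.
have t0 : 0 < t by rewrite !lt_min !divr_gt0.
have tr : t < r by rewrite gt_min; apply/orP; left; lra.
have tr' : t < r'.
  by rewrite gt_min; apply/orP; right; rewrite gt_min; apply/orP; left; lra.
have te : t * (2 * (M * K) + 1) <= e.
  by rewrite -ler_pdivlMr// /t !ge_min lexx !orbT.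
pose P h := F p + A * h + B * h ^+ 2.
have key h : nc h = t -> nc (P h) ^+ 2 - 2 * M * (K * t ^+ 3) + e * nc (p + h - z) ^+ 2 <=
   nc (F p) ^+ 2 + e * nc (p - z) ^+ 2.
  move=> ht; apply: le_trans (Hmax h _); last by rewrite ht.
  rewrite lerD2r.
  have -> : F (p + h) = P h + (F (p + h) - F p - A * h - B * h ^+ 2) by rewrite /P; ring.
  apply: normc_sqrD_ge; first by rewrite normc_poly2// ht (le_trans (ltW tr')).
  by rewrite -ht H// ht.
have nt (x y : R) : x ^+ 2 + y ^+ 2 = t ^+ 2 -> nc (x +i* y) = t.
  by move=> /= ->; rewrite sqrtr_sqr gtr0_norm.
have k1 := key (t +i* 0) (nt t 0 _).
have k2 := key ((- t) +i* 0) (nt (- t) 0 _).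
have k3 := key (0 +i* t) (nt 0 t _).
have k4 := key (0 +i* (- t)) (nt 0 (- t) _).
have {}k1 := k1 ltac:(ring).
have {}k2 := k2 ltac:(ring).
have {}k3 := k3 ltac:(ring).
have {}k4 := k4 ltac:(ring).
have nP (x y : R) : nc (P (x +i* y)) ^+ 2 =
    (complex.Re (F p) + (complex.Re A * x - complex.Im A * y) +
      (complex.Re B * (x * x - y * y) - complex.Im B * (x * y + y * x))) ^+ 2 +
    (complex.Im (F p) + (complex.Re A * y + complex.Im A * x) +
      (complex.Re B * (x * y + y * x) + complex.Im B * (x * x - y * y))) ^+ 2.
  by rewrite normc_sqr /P expr2 !ReImE.
(* The sums of h, of h^2 and of h conj(h)^2 over the four points vanish, so all cross terms
   cancel. *)
have s1 : nc (P (t +i* 0)) ^+ 2 + nc (P ((- t) +i* 0)) ^+ 2 + nc (P (0 +i* t)) ^+ 2 +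
   nc (P (0 +i* (- t))) ^+ 2 =
   4 * nc (F p) ^+ 2 + 4 * nc A ^+ 2 * t ^+ 2 + 4 * nc B ^+ 2 * t ^+ 4.
  by rewrite !nP !normc_sqr; move: (complex.Re (F p)) (complex.Im (F p)) => a b; ring.
have nz (x y : R) : nc (p + (x +i* y) - z) ^+ 2 =
    (complex.Re p + x - complex.Re z) ^+ 2 + (complex.Im p + y - complex.Im z) ^+ 2.
  by rewrite normc_sqr !ReImE.
have s2 : nc (p + (t +i* 0) - z) ^+ 2 + nc (p + ((- t) +i* 0) - z) ^+ 2 +
   nc (p + (0 +i* t) - z) ^+ 2 + nc (p + (0 +i* (- t)) - z) ^+ 2 =
   4 * nc (p - z) ^+ 2 + 4 * t ^+ 2.
  by rewrite !nz !normc_sqr !ReImE; ring.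
have a0 : 0 <= 4 * nc A ^+ 2 * t ^+ 2.
  by rewrite !mulr_ge0 ?exprn_ge0 ?normc_ge0// ltW.
have b0 : 0 <= 4 * nc B ^+ 2 * t ^+ 4.
  by rewrite !mulr_ge0 ?exprn_ge0 ?normc_ge0// ltW.
have : e * (4 * nc (p - z) ^+ 2 + 4 * t ^+ 2) - 8 * M * (K * t ^+ 3) <=
    4 * (e * nc (p - z) ^+ 2).
  rewrite -s2; lra.
have -> : 8 * M * (K * t ^+ 3) = 4 * t ^+ 2 * (t * (2 * (M * K))) by ring.
have t20 : 0 < t ^+ 2 by rewrite exprn_gt0.
move=> h; have : t ^+ 2 * e <= t ^+ 2 * (t * (2 * (M * K))) by lra.
by rewrite ler_pM2l// => h'; lra.
Qed.

(** The extreme value theorem is used on rectangles of [R * R], which are compact as products of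
    segments. *)
Definition plane (x : R * R) : R[i] := x.1 +i* x.2.

Lemma jet2_continuous_normc F (x : R * R) : jet2 F (plane x) ->
  {for x, continuous (fun y => nc (F (plane y)))}.
Proof.
move=> /jet2_lipschitz[L [r [L0 /andP[r0 r1] H]]].
apply/cvgrPdist_lt => e e0.
pose d := Num.min (r / 2) (e / L / 2).
have d0 : 0 < d by rewrite lt_min !divr_gt0.
exists (ball x.1 d, ball x.2 d); first by split; exact: nbhsx_ballx.
move=> y [/= y1 y2]; rewrite /ball/= in y1 y2.
have yE : plane y = plane x + (plane y - plane x) by ring.
have hd : nc (plane y - plane x) < d + d.
  rewrite (le_lt_trans (normc_le_ReIm _))// !ReImE/=.
  by rewrite ltrD// distrC.
have hr : nc (plane y - plane x) < r.
  apply: (lt_le_trans hd); rewrite [leRHS](splitr r); apply: lerD; by rewrite ge_min lexx.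
have he : nc (plane y - plane x) < e / L.
  apply: (lt_le_trans hd); rewrite [leRHS](splitr (e / L)).
  by apply: lerD; rewrite ge_min lexx orbT.
have := H _ hr; rewrite -yE => H'.
have H2 : nc (F (plane y) - F (plane x)) < e.
  by rewrite (le_lt_trans H')// mulrC -ltr_pdivlMr.
apply: le_lt_trans H2.
rewrite ler_norml; apply/andP; split.
  rewrite lerNl opprB lerBlDr.
  by rewrite -[X in nc X <= _](subrK (F (plane x))) normcD.
rewrite lerBlDr -[X in _ <= X + _]normcN opprB.
by rewrite -[X in nc X <= _](subrK (F (plane y))) normcD.
Qed.

(* The weight exp (N (iz - (z - s)^2/4)) is small, compared with its value at
   the target point, on the three sides of a rectangle where G is not known to
   vanish; let N tend to infinity in the maximum principle. *)
Lemma strip_identity_upper G (V0 : R) : V0 <= 2 ->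
  (forall z, `|complex.Im z| < V0 -> jet2 G z) ->
  (forall s : R, G s%:C = 0) ->
  forall z, 0 <= complex.Im z < V0 -> G z = 0.
Proof.
move=> V02 jG G0 z1 /andP[v10 v1V]; set v1 := complex.Im z1 in v10 v1V.
set s1 := complex.Re z1.
(* V < V0 keeps the closed rectangle [K] inside the strip where jets are given. *)
pose V := (v1 + V0) / 2.
have Vlo : v1 < V by rewrite /V; lra.
have Vhi : V < V0 by rewrite /V; lra.
pose K : set (R * R) := `[s1 - 4, s1 + 4]%classic `*` `[0, V]%classic.
have cK : compact K by apply: compact_setX; exact: segment_compact.
have z1E : z1 = plane (s1, v1) by apply: complex_ext.
have Kz1 : K (s1, v1).
  by rewrite /K; split; rewrite /= in_itv/=; apply/andP; split; lra.
have jK x : K x -> jet2 G (plane x).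
  move=> [_]; rewrite /= in_itv/= => /andP[a b]; apply: jG.
  by rewrite /= ger0_norm// (le_lt_trans b).
have contK F : (forall x, K x -> jet2 F (plane x)) ->
    {within K, continuous (fun x => nc (F (plane x)))}.
  move=> jF; apply: continuous_in_subspaceT => x; rewrite inE => Kx.
  exact/jet2_continuous_normc/jF.
have [m Km Hm] := compact_EVT_max (ex_intro _ _ Kz1) cK (contK _ jK).
have {}Hm y (Ky : K y) := Hm y (mem_set Ky).
set M := nc (G (plane m)) in Hm.
pose phi z := z * 'i + (- 4^-1)%:C * ((z - s1%:C) * (z - s1%:C)).
(* Re [phi] is [- q1] at the target and at most [- d] on the top and vertical sides; on the latter
   the half-width 4 contributes 4^2/4 = 4 > d. The map t - t^2/4 increases on [0, 2], whence V0 <= 2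
   and q1 < d. *)
pose q1 := v1 - v1 ^+ 2 / 4.
pose d := V - V ^+ 2 / 4.
have q1d : q1 < d.
  rewrite /q1 /d; have : 0 < (V - v1) * (4 - V - v1) by rewrite mulr_gt0; lra.
  by lra.
have Rephi z : complex.Re (phi z) =
    - complex.Im z - ((complex.Re z - s1) ^+ 2 - complex.Im z ^+ 2) / 4.
  by rewrite /phi ReD ReiNIm !ReImE; field.
(* The perturbation e|z - s1|^2 rules out interior maxima; on the rectangle |z - s1|^2 <= 4^2 + 2^2
   = 20. It is removed afterwards by letting e tend to 0. *)
have key (N e : R) : 0 <= N -> 0 < e ->
    nc (G z1) ^+ 2 * expR (- (N * q1)) ^+ 2 <= M ^+ 2 * expR (- (N * d)) ^+ 2 + e * 20.
  move=> N0 e0; pose F z := G z * cexp (N%:C * phi z).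
  have jid (w : R[i]) : jet2 (fun z => z - s1%:C) w.
    apply: jet2D; [exact: jet2_id|exact: jet2_cst].
  have jF x : K x -> jet2 F (plane x).
    move=> Kx; apply: jet2M; first exact: jK.
    apply: (@jet2_comp _ (@cexp R)); last exact: jet2_cexp.
    apply: jet2M; first exact: jet2_cst.
    apply: jet2D; apply: jet2M; [exact: jet2_id|exact: jet2_cst|exact: jet2_cst|].
    by apply: jet2M; exact: jid.
  pose u x := nc (F (plane x)) * nc (F (plane x)) +
     e * (nc (plane x - s1%:C) * nc (plane x - s1%:C)).
  have cu : {within K, continuous u}.
    have c1 := contK _ jF.
    have c2 := contK _ (fun x _ => jid (plane x)).
    move=> x; apply: cvgD; first by apply: cvgM; [exact: c1|exact: c1].
    apply: cvgM; first exact: cvg_cst.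
    by apply: cvgM; [exact: c2|exact: c2].
  have [x Kx Hx] := compact_EVT_max (ex_intro _ _ Kz1) cK cu.
  have {}Kx := set_mem Kx.
  have {}Hx y (Ky : K y) := Hx y (mem_set Ky).
  have nF z : nc (F z) = nc (G z) * expR (N * complex.Re (phi z)).
    by rewrite /F Normc.normcM normc_cexp ReM/= mul0r subr0.
  have uz1 : nc (G z1) ^+ 2 * expR (- (N * q1)) ^+ 2 <= u (s1, v1).
    rewrite /u -z1E nF Rephi -/v1 -/s1 subrr.
    have -> : - v1 - (0 ^+ 2 - v1 ^+ 2) / 4 = - q1 by rewrite /q1; ring.
    rewrite mulrN -!expr2 exprMn lerDl.
    by rewrite mulr_ge0 ?(ltW e0)// exprn_ge0// normc_ge0.
  apply: (le_trans uz1); apply: (le_trans (Hx _ Kz1)).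
  have [] := Kx; rewrite /= !in_itv/= => /andP[xa xb] /andP[ya yb].
  have nz : nc (plane x - s1%:C) * nc (plane x - s1%:C) <= 20.
    rewrite -expr2 normc_sqr !ReImE/= subr0.
    have : 0 <= (x.1 - (s1 - 4)) * (s1 + 4 - x.1) by rewrite mulr_ge0 ?subr_ge0.
    have : 0 <= x.2 * (2 - x.2) by rewrite mulr_ge0//; lra.
    by lra.
  rewrite /u lerD//; last by rewrite ler_pM2l.
  (* At the maximum either the weight is at most exp (- N d), or the point is on the real line,
     where [G] vanishes; both give the bound. What remains is an interior maximum, which is
     impossible. *)
  have [bad|good] := pselect (complex.Re (phi (plane x)) <= - d \/ x.2 = 0).
    rewrite -expr2 nF exprMn; case: bad => [bad|x20]; last first.
      have -> : plane x = (x.1)%:C by rewrite /plane x20.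
      by rewrite G0 Normc.normc0 expr0n mul0r mulr_ge0// exprn_ge0// ?expR_ge0// normc_ge0.
    apply: ler_pM; rewrite ?exprn_ge0 ?normc_ge0 ?expR_ge0//.
      by rewrite lerXn2r ?nnegrE ?normc_ge0// Hm.
    rewrite lerXn2r ?nnegrE ?expR_ge0// ler_expR -mulrN ler_wpM2l//.
  exfalso; move/not_orP: good => [good x20].
  have y0 : 0 < x.2 by rewrite lt_def ya andbT; apply/eqP.
  (* Re [phi] > - d keeps the point off the top side and off the vertical sides. *)
  have q : x.2 - x.2 ^+ 2 / 4 + (x.1 - s1) ^+ 2 / 4 < d.
    move/negP: good; rewrite -ltNge Rephi/=; lra.
  have yV : x.2 < V.
    rewrite lt_neqAle yb andbT; apply/eqP => yV; move: q; rewrite yV /d.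
    by have := sqr_ge0 (x.1 - s1); lra.
  have dx : (x.1 - s1) ^+ 2 < 16.
    have : 0 <= x.2 * (4 - x.2) by rewrite mulr_ge0//; lra.
    have : 0 <= V ^+ 2 by rewrite sqr_ge0.
    rewrite /d in q; lra.
  have x1 : s1 - 4 < x.1.
    by rewrite lt_neqAle xa andbT; apply/eqP => E; move: dx; rewrite -E; lra.
  have x2 : x.1 < s1 + 4.
    by rewrite lt_neqAle xb andbT; apply/eqP => E; move: dx; rewrite E; lra.
  pose r := Num.min (Num.min (x.1 - (s1 - 4)) (s1 + 4 - x.1)) (Num.min x.2 (V - x.2)).
  have r0 : 0 < r by rewrite !lt_min !subr_gt0 x1 x2 y0 yV.
  apply: (@jet2_no_strict_max F (plane x) s1%:C e r) => //; first exact: jF.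
  move=> h; rewrite !lt_min => /andP[/andP[r1 r2] /andP[r3 r4]].
  have hre := norm_Re_le h; have him := norm_Im_le h.
  have := Hx (x.1 + complex.Re h, x.2 + complex.Im h); rewrite /u.
  have -> : plane (x.1 + complex.Re h, x.2 + complex.Im h) = plane x + h.
    by apply: complex_ext; rewrite !ReImE.
  rewrite !expr2; apply; split; rewrite /= in_itv/=; move: hre him; rewrite !ler_norml;
    clear -r1 r2 r3 r4; move=> /andP[? ?] /andP[? ?]; apply/andP; split; lra.
have {}key (N : R) : 0 <= N -> nc (G z1) ^+ 2 * expR (- (N * q1)) ^+ 2 <= M ^+ 2 * expR (- (N * d)) ^+ 2.
  move=> N0; apply/ler_addgt0Pr => e e0.
  have := key N (e / 20) N0; rewrite divr_gt0// => /(_ isT).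
  by rewrite divfK.
apply/eqP; rewrite -normc_eq0; apply/negPn/negP => Gn0.
have g0 : 0 < nc (G z1) ^+ 2 by rewrite exprn_gt0// lt_def Gn0 normc_ge0.
have M20 : 0 <= M ^+ 2 by exact: sqr_ge0.
(* A single [N] suffices: it makes 2N(d - q1) = X with X = M^2/|G z1|^2, and exp X >= 1 + X turns |G
   z1|^2 exp X <= M^2 into |G z1|^2 + M^2 <= M^2. *)
pose N := (M ^+ 2 / nc (G z1) ^+ 2) / (2 * (d - q1)).
have dq0 : 0 < 2 * (d - q1) by rewrite mulr_gt0// subr_gt0.
have N0 : 0 <= N by rewrite !divr_ge0// ltW.
have := key N N0.
have sq (x : R) : expR x ^+ 2 = expR (2 * x) by rewrite -expRM_natl.
rewrite !sq => h.
have {h} : nc (G z1) ^+ 2 * expR (M ^+ 2 / nc (G z1) ^+ 2) <= M ^+ 2.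
  have := ler_wpM2r (expR_ge0 (2 * (N * d))) h.
  rewrite -(mulrA (nc _ ^+ 2)) -(mulrA (M ^+ 2)) -!expRD.
  have -> : 2 * - (N * d) + 2 * (N * d) = 0 by ring.
  have -> : 2 * - (N * q1) + 2 * (N * d) = M ^+ 2 / nc (G z1) ^+ 2.
    have <- : N * (2 * (d - q1)) = M ^+ 2 / nc (G z1) ^+ 2 by rewrite divfK ?gt_eqF.
    by ring.
  by rewrite expR0 mulr1.
have : nc (G z1) ^+ 2 * (1 + M ^+ 2 / nc (G z1) ^+ 2) <=
    nc (G z1) ^+ 2 * expR (M ^+ 2 / nc (G z1) ^+ 2).
  by rewrite ler_pM2l// expR_ge1Dx.
rewrite mulrDr mulr1 mulrC divfK ?gt_eqF// => a b; lra.
Qed.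

(** The lower half of the strip is the upper half for w -> G (- w). *)
Lemma strip_identity G (V0 : R) : V0 <= 2 ->
  (forall z, `|complex.Im z| < V0 -> jet2 G z) ->
  (forall s : R, G s%:C = 0) ->
  forall z, `|complex.Im z| < V0 -> G z = 0.
Proof.
move=> V2 jG G0 z zV; have [z0|z0] := leP 0 (complex.Im z).
  by apply: (strip_identity_upper V2 jG G0); rewrite z0/= -(ger0_norm z0).
rewrite -[z]opprK; apply: (@strip_identity_upper (fun w => G (- w)) _ V2).
- move=> w wV; have -> : (fun w => G (- w)) = (fun w => G ((-1) * w)).
    by apply/funext => x; rewrite mulN1r.
  apply: (@jet2_comp _ G); first by apply: jet2M; [exact: jet2_cst|exact: jet2_id].
  by apply: jG; rewrite mulN1r ImN normrN.
- by move=> s; rewrite -rmorphN G0.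
- by rewrite ImN oppr_ge0 (ltW z0)/= -(ltr0_norm z0).
Qed.

End MaximumPrinciple.

(** * Complex series and Fourier series *)

Section ComplexSeries.
Variable R : realType.
Implicit Types (u v : nat -> R[i]) (l : R[i]).

Definition ccvg u l : Prop := (u : nat -> R[i]^o) @ \oo --> (l : R[i]^o).

Lemma ccvgP u l : ccvg u l <->
  forall e : R, 0 < e -> \forall n \near \oo, nc (l - u n) < e.
Proof.
split => [/cvgrPdist_lt ul e e0|ul].
  have e0' : 0 < e%:C by rewrite -[X in X < _]/(0%:C) ltcR.
  by apply: filterS (ul _ e0') => n; rewrite -[X in X < _]/((nc (l - u n))%:C) ltcR.
apply/cvgrPdist_lt => e e0.
have er : 0 < complex.Re e by move: e0; rewrite ltcE/= => /andP[].
have -> : e = (complex.Re e)%:C.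
  by move: e0; rewrite ltcE/= => /andP[/eqP ei _]; case: e ei {er} => a b /= ->.
apply: filterS (ul _ er) => n h.
by rewrite -[X in X < _]/((nc (l - u n))%:C) ltcR.
Qed.

Lemma ccvg_Re u l : ccvg u l -> complex.Re (u n) @[n --> \oo] --> complex.Re l.
Proof.
move=> /ccvgP ul; apply/cvgrPdist_lt => e e0; apply: filterS (ul _ e0) => n.
by apply: le_lt_trans; have := norm_Re_le (l - u n); rewrite !ReImE.
Qed.

Lemma ccvg_Im u l : ccvg u l -> complex.Im (u n) @[n --> \oo] --> complex.Im l.
Proof.
move=> /ccvgP ul; apply/cvgrPdist_lt => e e0; apply: filterS (ul _ e0) => n.
by apply: le_lt_trans; have := norm_Im_le (l - u n); rewrite !ReImE.
Qed.

Lemma ccvg_ReIm u l : complex.Re (u n) @[n --> \oo] --> complex.Re l ->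
  complex.Im (u n) @[n --> \oo] --> complex.Im l -> ccvg u l.
Proof.
move=> /cvgrPdist_lt ul /cvgrPdist_lt vl; apply/ccvgP => e e0.
have e2 : 0 < e / 2 by rewrite divr_gt0.
near=> n; rewrite (le_lt_trans (normc_le_ReIm _))// !ReImE (splitr e) ltrD//.
  by near: n; exact: ul.
by near: n; exact: vl.
Unshelve. all: by end_near. Qed.

Lemma ccvg_unique u l l' : ccvg u l -> ccvg u l' -> l = l'.
Proof. by move=> h h'; apply: (cvg_unique (@norm_hausdorff _ R[i]^o) h h'). Qed.

Lemma ccvg_limn u l : ccvg u l -> limn (u : nat -> R[i]^o) = l.
Proof. by move=> h; apply: (cvg_lim (@norm_hausdorff _ R[i]^o) h). Qed.

Lemma ccvgD u v l l' : ccvg u l -> ccvg v l' -> ccvg (fun n => u n + v n) (l + l').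
Proof. exact: cvgD. Qed.

Lemma ccvgZ c u l : ccvg u l -> ccvg (fun n => c * u n) (c * l).
Proof. by move=> h; apply: (@cvgZr _ R[i]^o). Qed.

Definition csum u l : Prop := ccvg (series (u : nat -> R[i]^o)) l.

Lemma csumD u v l l' : csum u l -> csum v l' -> csum (fun n => u n + v n) (l + l').
Proof.
move=> h h'; rewrite /csum (_ : series _ = fun n => series (u : nat -> R[i]^o) n + series (v : nat -> R[i]^o) n).
  exact: (ccvgD h h').
by apply/funext => n; rewrite /series/= big_split.
Qed.

Lemma csumZ c u l : csum u l -> csum (fun n => c * u n) (c * l).
Proof.
move=> /(@ccvgZ c); rewrite /csum; congr ccvg.
by apply/funext => n; rewrite /series/= mulr_sumr.
Qed.

Lemma csum_limn u l : csum u l -> limn (series (u : nat -> R[i]^o)) = l.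
Proof. exact: ccvg_limn. Qed.

Lemma normc_series_le u (b : nat -> R) n : (forall n, nc (u n) <= b n) ->
  cvgn (series b) -> nc (series (u : nat -> R[i]^o) n) <= limn (series b).
Proof.
move=> ub cb; rewrite /series/= (le_trans (normc_sum _ _ _))//.
apply: (@le_trans _ _ (series b n)); first by apply: ler_sum.
apply: nondecreasing_cvgn_le => //; apply: nondecreasing_series => k _ _.
exact: le_trans (normc_ge0 _) (ub k).
Qed.

Lemma cvg_seriesMl (c : R) (b : nat -> R) : cvgn (series b) ->
  series (fun n => c * b n) @ \oo --> c * limn (series b).
Proof.
move=> cb; have -> : series (fun n => c * b n) = fun n => c * series b n.
  by apply/funext => n; rewrite /series/= mulr_sumr.
by apply: cvgM; [exact: cvg_cst|exact: cb].
Qed.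

(** The real and imaginary parts converge absolutely; the bound on the sum is inherited from the
    partial sums, up to an arbitrary e. *)
Lemma dominated_csum u (b : nat -> R) : (forall n, nc (u n) <= b n) ->
  cvgn (series b) -> exists2 l, csum u l & nc l <= limn (series b).
Proof.
move=> ub cb; have b0 n : 0 <= b n by exact: le_trans (normc_ge0 _) (ub n).
have cR : cvgn (series (fun n => complex.Re (u n))).
  apply: normed_cvg; apply: (series_le_cvg _ b0 _ cb) => n /=; first exact: normr_ge0.
  exact: le_trans (norm_Re_le _) (ub n).
have cI : cvgn (series (fun n => complex.Im (u n))).
  apply: normed_cvg; apply: (series_le_cvg _ b0 _ cb) => n /=; first exact: normr_ge0.
  exact: le_trans (norm_Im_le _) (ub n).
pose l := limn (series (fun n => complex.Re (u n))) +i* limn (series (fun n => complex.Im (u n))).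
have ul : csum u l.
  apply: ccvg_ReIm.
    under eq_fun do rewrite /series/= Re_sum.
    exact: cR.
  under eq_fun do rewrite /series/= Im_sum.
  exact: cI.
exists l => //; apply/ler_addgt0Pr => e e0.
have [N _ HN] := (ccvgP _ _).1 ul e e0.
have := HN N (leqnn N); set s := series _ N => h.
rewrite -[l](subrK s) (le_trans (normcD _ _))// addrC lerD ?(ltW h)//.
exact: normc_series_le.
Qed.

End ComplexSeries.

(** * Fourier series: a summable majorant and the Taylor expansion *)

Section FourierSeries.
Variable R : realType.
Implicit Types (b : nat -> R[i]) (lam : nat -> R) (z : R[i]).

(** In other words, the power series with coefficients [b l] has radius of convergence at least
    1. *)
Definition subexp b : Prop := forall c : R, 0 < c ->
  exists K : R, forall l, nc (b l) <= K * expR (c * l%:R).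

(** Growth at rate c/2 leaves a geometric series of ratio exp (- c/2). *)
Lemma subexp_cvg b (c : R) : subexp b -> 0 < c ->
  cvgn (series (fun l => nc (b l) * expR (- (c * l%:R)))).
Proof.
move=> sb c0; have [K HK] := sb _ (divr_gt0 c0 (ltr0Sn _ 1)).
have K0 : 0 <= K.
  by have := le_trans (normc_ge0 _) (HK 0%N); rewrite mulr0 expR0 mulr1.
apply: (@series_le_cvg _ _ (geometric K (expR (- (c / 2))))).
- by move=> l; rewrite mulr_ge0 ?normc_ge0 ?expR_ge0.
- by move=> l; rewrite /geometric/= mulr_ge0// exprn_ge0// expR_ge0.
- move=> l; rewrite /geometric/=.
  apply: (le_trans (ler_wpM2r (expR_ge0 _) (HK l))).
  rewrite -mulrA ler_wpM2l// -expRD -expRM_natl ler_expR.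
  by rewrite le_eqVlt; apply/orP; left; apply/eqP; field.
- apply: is_cvg_geometric_series; rewrite ger0_norm ?expR_ge0// -[ltRHS]expR0 ltr_expR.
  by rewrite oppr_lt0 divr_gt0.
Qed.

(** Frequencies are only asked to stay within bounded distance of 2 pi l; this covers both the index
    shift [n0] and the exponents kappa. *)
Definition fterm b lam z : nat -> R[i] := fun l => b l * cexp ((lam l)*i * z).

Lemma Re_imag (x : R) z : complex.Re (x*i * z) = - (x * complex.Im z).
Proof. by rewrite ReM Re_mk Im_mk mul0r sub0r. Qed.

(** Cube e (1 + x) <= 1 + e x <= exp (e x). *)
Lemma cube_exp_bound (x e : R) : 0 <= x -> 0 < e <= 1 ->
  (1 + x) ^+ 3 <= e ^- 3 * expR (3 * e * x).
Proof.
move=> x0 /andP[e0 e1].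
have -> : expR (3 * e * x) = expR (e * x) ^+ 3 by rewrite -expRM_natl; congr expR; ring.
rewrite -exprVn -exprMn lerXn2r ?nnegrE ?addr_ge0 ?mulr_ge0 ?expR_ge0 ?invr_ge0 ?(ltW e0)//.
apply: (@le_trans _ _ (e^-1 * (1 + e * x))); last first.
  by rewrite ler_wpM2l ?invr_ge0 ?(ltW e0)// expR_ge1Dx.
by rewrite mulrDr mulr1 mulKf ?gt_eqF// lerD2r invr_ge1// ?unitf_gt0.
Qed.

(** One majorant for the whole expansion at [z]: (1 + |lam|)^3 pays for up to three derivatives of a
    term, and exp (|lam| y/2), with y = Im z, for a displacement |h| < y/2. *)
Lemma fterm_majorant b lam (D : R) z : subexp b ->
  (forall l, `|lam l - 2 * pi * l%:R| <= D) -> 0 < complex.Im z ->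
  cvgn (series (fun l => nc (fterm b lam z l) *
     ((1 + `|lam l|) ^+ 3 * expR (`|lam l| * (complex.Im z / 2))))).
Proof.
move=> sb lD; set y := complex.Im z => y0.
have D0 : 0 <= D by exact: le_trans (normr_ge0 _) (lD 0%N).
(* With 3e <= y/4 the total exponent is at most - lam y + (3/4)|lam| y <= - (pi/2) y l + (7/4) D y,
   the origin of [c0] and [K]. *)
pose e := Num.min 1 (y / 12).
have e0 : 0 < e by rewrite lt_min ltr01 divr_gt0.
have e1 : e <= 1 by rewrite ge_min lexx.
have ey : e <= y / 12 by rewrite ge_min lexx orbT.
have c0 : 0 < pi / 2 * y :> R by rewrite mulr_gt0// divr_gt0// pi_gt0.
pose K : R := e ^- 3 * expR (7 / 4 * D * y).
have cv : cvgn (series (fun l => K * (nc (b l) * expR (- (pi / 2 * y * l%:R))))).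
  exact: cvgP (@cvg_seriesMl _ K _ (subexp_cvg sb c0)).
apply: series_le_cvg cv => l.
- by rewrite !mulr_ge0 ?normc_ge0 ?exprn_ge0 ?expR_ge0// addr_ge0.
- by rewrite !mulr_ge0 ?normc_ge0 ?expR_ge0// invr_ge0 exprn_ge0// ltW.
rewrite /fterm Normc.normcM normc_cexp Re_imag -/y.
have := @cube_exp_bound `|lam l| e (normr_ge0 _); rewrite e0 e1 => /(_ isT) h.
apply: (@le_trans _ _ (nc (b l) * expR (- (lam l * y)) *
   (e ^- 3 * expR (3 * e * `|lam l|) * expR (`|lam l| * (y / 2))))).
  by rewrite ler_wpM2l ?mulr_ge0 ?normc_ge0 ?expR_ge0// ler_wpM2r ?expR_ge0.
have -> : K * (nc (b l) * expR (- (pi / 2 * y * l%:R))) =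
    e ^- 3 * nc (b l) * expR (7 / 4 * D * y - pi / 2 * y * l%:R).
  by rewrite /K expRD; ring.
have -> : nc (b l) * expR (- (lam l * y)) *
    (e ^- 3 * expR (3 * e * `|lam l|) * expR (`|lam l| * (y / 2))) =
    e ^- 3 * nc (b l) * expR (- (lam l * y) + 3 * e * `|lam l| + `|lam l| * (y / 2)).
  by rewrite !expRD; ring.
rewrite ler_wpM2l ?mulr_ge0 ?invr_ge0 ?exprn_ge0 ?(ltW e0) ?normc_ge0// ler_expR.
have := lD l; rewrite ler_norml => /andP[l1 l2].
have l0 : 0 <= pi * l%:R :> R by rewrite mulr_ge0// pi_ge0.
have al : `|lam l| <= 2 * (pi * l%:R) + D by rewrite ler_norml; apply/andP; split; lra.
have p1 : 0 <= (2 * (pi * l%:R) + D - `|lam l|) * y by rewrite mulr_ge0 ?subr_ge0// ltW.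
have p2 : 0 <= (lam l - (2 * (pi * l%:R) - D)) * y by rewrite mulr_ge0 ?(ltW y0)//; lra.
have p3 : 0 <= (y / 12 - e) * `|lam l| by rewrite mulr_ge0// subr_ge0.
lra.
Qed.

Lemma fterm_csum b lam (D : R) z : subexp b ->
  (forall l, `|lam l - 2 * pi * l%:R| <= D) -> 0 < complex.Im z ->
  csum (fterm b lam z) (limn (series (fterm b lam z : nat -> R[i]^o))).
Proof.
move=> sb lD y0; have := fterm_majorant sb lD y0.
move=> /(@dominated_csum _ (fterm b lam z))[l|l hl _]; last by rewrite (csum_limn hl).
rewrite ler_peMr ?normc_ge0// mulr_ege1 ?exprn_ege1 ?lerDl// -[leLHS]expR0 ler_expR.
by rewrite mulr_ge0// divr_ge0// ltW.
Qed.

(** Each term is expanded by [cexp_taylor2]; the coefficients sum to [A] and [B], and under the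
    majorant the remainders sum to at most 8 S |h|^3. *)
Lemma jet2_fourier b lam (D : R) z : subexp b ->
  (forall l, `|lam l - 2 * pi * l%:R| <= D) -> 0 < complex.Im z ->
  jet2 (fun w => limn (series (fterm b lam w : nat -> R[i]^o))) z.
Proof.
move=> sb lD y0; have cv := fterm_majorant sb lD y0.
set y := complex.Im z in y0 cv; set w := fun l => _ in cv.
have wE l x : 0 <= x -> x <= (1 + `|lam l|) ^+ 3 * expR (`|lam l| * (y / 2)) ->
    nc (fterm b lam z l) * x <= w l by move=> x0 h; rewrite ler_wpM2l// normc_ge0.
have e1 l : 1 <= expR (`|lam l| * (y / 2)).
  by rewrite -[leLHS]expR0 ler_expR mulr_ge0// divr_ge0// ltW.
have dom (c : nat -> R[i]) : (forall l, nc (c l) <= (1 + `|lam l|) ^+ 3) ->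
    exists A, csum (fun l => fterm b lam z l * c l) A.
  move=> cl; have [|A hA _] := @dominated_csum _ (fun l => fterm b lam z l * c l) w _ cv.
    move=> l; rewrite Normc.normcM wE ?normc_ge0//.
    by rewrite (le_trans (cl l))// ler_peMr// exprn_ge0// addr_ge0.
  by exists A.
have nI l : nc (lam l)*i = `|lam l| by rewrite /= expr0n add0r sqrtr_sqr.
have [A hA] : exists A, csum (fun l => fterm b lam z l * (lam l)*i) A.
  apply: dom => l; rewrite nI; have : 0 <= `|lam l| by [].
  by move: `|lam l| => x x0; rewrite !exprS expr0; nra.
have [B hB] : exists B, csum (fun l => fterm b lam z l * ((lam l)*i ^+ 2 / 2)) B.
  apply: dom => l; rewrite Normc.normcM normcX nI Normc.normcV.
  have -> : nc 2 = 2 :> R by have := @normc_real R 2; rewrite rmorph_nat normr_nat.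
  have : 0 <= `|lam l| by [].
  by move: `|lam l| => x x0; rewrite !exprS expr0; nra.
pose S := limn (series w).
have S0 : 0 <= S.
  apply: le_trans (normc_ge0 _) (@normc_series_le _ (fterm b lam z) w 0%N _ cv) => l.
  by rewrite -[leLHS]mulr1 wE// mulr_ege1// exprn_ege1// lerDl.
pose r := Num.min 1 (y / 2).
exists A, B, (8 * S), r; split.
- by rewrite mulr_ge0.
- by rewrite lt_min ltr01 divr_gt0//= ge_min lexx.
move=> h; rewrite lt_min => /andP[h1 hy].
pose E l := fterm b lam z l *
  (cexp ((lam l)*i * h) - 1 - (lam l)*i * h - ((lam l)*i * h) ^+ 2 / 2).
have [e he hS] : exists2 e, csum E e & nc e <= limn (series (fun l => 8 * nc h ^+ 3 * w l)).
  apply: dominated_csum; last first.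
    exact: cvgP (@cvg_seriesMl _ _ _ cv).
  move=> l; rewrite Normc.normcM; have := cexp_taylor2 ((lam l)*i * h).
  rewrite Normc.normcM nI => ht.
  apply: (le_trans (ler_wpM2l (normc_ge0 _) ht)).
  rewrite (_ : _ * (_ * _) = 8 * nc h ^+ 3 *
     (nc (fterm b lam z l) * (`|lam l| ^+ 3 * expR (`|lam l| * nc h)))); last by ring.
  rewrite ler_wpM2l ?mulr_ge0 ?exprn_ge0 ?normc_ge0//.
  rewrite wE ?mulr_ge0 ?exprn_ge0 ?expR_ge0// ler_pM ?exprn_ge0 ?expR_ge0//.
    by rewrite lerXn2r ?nnegrE ?addr_ge0// lerDr.
  by rewrite ler_expR ler_wpM2l// ltW.
have zh : 0 < complex.Im (z + h).
  rewrite ImD -/y; have := norm_Im_le h; rewrite ler_norml => /andP[? _].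
  by have := y0; lra.
pose F w := limn (series (fterm b lam w : nat -> R[i]^o)).
rewrite -/(F z) -/(F (z + h)).
have hF := fterm_csum sb lD y0; rewrite -/(F z) in hF.
have hFh := fterm_csum sb lD zh; rewrite -/(F (z + h)) in hFh.
have := csumD (csumD (csumD hF (@csumZ _ h _ _ hA)) (@csumZ _ (h ^+ 2) _ _ hB)) he.
rewrite (_ : (fun n => _) = fterm b lam (z + h)); last first.
  by apply/funext => l; rewrite /E /fterm [_ * (z + h)]mulrDr cexpD; field.
move=> /(ccvg_unique hFh) ->.
have -> : F z + h * A + h ^+ 2 * B + e - F z - A * h - B * h ^+ 2 = e by ring.
rewrite (le_trans hS)//.
have -> := cvg_lim (@Rhausdorff R) (@cvg_seriesMl _ (8 * nc h ^+ 3) _ cv).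
by rewrite -/S mulrAC.
Qed.

End FourierSeries.

Section Growth.
Variable R : realType.
Implicit Types (a : int -> R[i]) (kap : R).

Lemma subexp_growth_subexp a (n0 : int) : subexp_growth a ->
  subexp (fun l => a (shifted_index n0 l)).
Proof.
move=> [C C0 /eqO_exP[k k0 [N _ HN]]] c c0.
have kr : 0 <= complex.Re k by move: k0; rewrite ltcE/= => /andP[_ /ltW].
have kE : k = (complex.Re k)%:C.
  by move: k0; rewrite ltcE/= => /andP[/eqP ki _]; case: k ki {kr HN} => x y /= ->.
pose k' := complex.Re k * expR (C ^+ 2 / (4 * c)).
have k'0 : 0 <= k' by rewrite mulr_ge0// expR_ge0.
have large (n : nat) : (N <= n)%N -> nc (a n%:Z) <= k' * expR (c * n%:R).
  move=> Nn.
  have : (nc (a n%:Z))%:C <= (complex.Re k)%:C * (nc (expR (C * Num.sqrt n%:R))%:C)%:C.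
    by rewrite -kE; exact: HN.
  rewrite normc_real -rmorphM lecR.
  rewrite ger0_norm ?expR_ge0// => /le_trans; apply.
  rewrite /k' -mulrA ler_wpM2l// -expRD ler_expR.
  have {2}-> : n%:R = Num.sqrt n%:R ^+ 2 :> R by rewrite sqr_sqrtr.
  move: (Num.sqrt _) => s.
  (* Completing the square: C s <= C^2/(4c) + c s^2 with s = sqrt n. *)
  have : 0 <= c * (s - C / (2 * c)) ^+ 2 by rewrite mulr_ge0 ?sqr_ge0// ltW.
  have -> : c * (s - C / (2 * c)) ^+ 2 = C ^+ 2 / (4 * c) + c * s ^+ 2 - C * s.
    by field; rewrite gt_eqF.
  by rewrite subr_ge0.
(* From l = N1 on, the index l - n0 is a natural number >= N. The finitely many earlier terms,
   negative indices included, are covered by the constant [K0]. *)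
pose N1 := (N + `|n0|)%N.
pose K0 := \sum_(i < N1) nc (a (shifted_index n0 i)).
have K00 : 0 <= K0 by apply: sumr_ge0 => i _; exact: normc_ge0.
exists (k' * expR (c * `|n0|%N%:R) + K0) => l.
have [lN|lN] := ltnP l N1.
  apply: (@le_trans _ _ K0).
    rewrite /K0 (bigD1 (Ordinal lN))//= lerDl; apply: sumr_ge0 => i _; exact: normc_ge0.
  rewrite -[leLHS]mulr1 ler_pM// ?lerDr ?mulr_ge0 ?expR_ge0//.
  by rewrite -[leLHS]expR0 ler_expR mulr_ge0// ltW.
have [n nE] : exists n : nat, shifted_index n0 l = n%:Z.
  by exists `|shifted_index n0 l|%N; rewrite /shifted_index; rewrite /N1 in lN; lia.
rewrite nE; move: nE; rewrite /shifted_index => nE.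
have Nn : (N <= n)%N by rewrite /N1 in lN; lia.
have nl : (n <= l + `|n0|)%N by lia.
rewrite (le_trans (large _ Nn))// mulrDl ler_wpDr ?mulr_ge0 ?expR_ge0//.
rewrite -[leRHS]mulrA ler_wpM2l// -expRD ler_expR -mulrDr ler_wpM2l ?(ltW c0)//.
by rewrite -natrD ler_nat addnC.
Qed.

Definition freq kap (n0 : int) (l : nat) : R := 2 * pi * ((shifted_index n0 l)%:~R + kap).

Lemma freq_bound kap (n0 : int) l :
  `|freq kap n0 l - 2 * pi * l%:R| <= `|2 * pi * (kap - n0%:~R)|.
Proof.
rewrite le_eqVlt; apply/orP; left; apply/eqP; congr `|_|.
by rewrite /freq /shifted_index rmorphB/= -pmulrn; ring.
Qed.

End Growth.

(** * Integrals of bounded measurable functions of compact support *)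

Section TameFunctions.
Variable R : realType.
Implicit Types (h g : R -> R[i]) (al be M : R).

Local Notation mu := (@lebesgue_measure R).
Local Notation D := (`]0, +oo[%classic : set R).

Definition cmeas h : Prop :=
  measurable_fun D (fun x => complex.Re (h x)) /\
  measurable_fun D (fun x => complex.Im (h x)).

Lemma cmeas_cst (c : R[i]) : cmeas (fun=> c).
Proof. by split; exact: measurable_cst. Qed.

Lemma cmeasD h g : cmeas h -> cmeas g -> cmeas (fun x => h x + g x).
Proof.
move=> [h1 h2] [g1 g2]; split.
  under [X in measurable_fun _ X]eq_fun do rewrite ReD.
  exact: measurable_funD.
under [X in measurable_fun _ X]eq_fun do rewrite ImD.
exact: measurable_funD.
Qed.

Lemma cmeasM h g : cmeas h -> cmeas g -> cmeas (fun x => h x * g x).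
Proof.
move=> [h1 h2] [g1 g2]; split.
  under [X in measurable_fun _ X]eq_fun do rewrite ReM.
  by apply: measurable_funB; exact: measurable_funM.
under [X in measurable_fun _ X]eq_fun do rewrite ImM.
by apply: measurable_funD; exact: measurable_funM.
Qed.

Lemma cmeas_real (f : R -> R) : measurable_fun D f -> cmeas (fun x => (f x)%:C).
Proof. by move=> mf; split => //; exact: measurable_cst. Qed.

Lemma cmeas_sum (I : Type) (s : seq I) (h : I -> R -> R[i]) :
  (forall i, cmeas (h i)) -> cmeas (fun x => \sum_(i <- s) h i x).
Proof.
move=> mh; elim: s => [|i s ih].
  by under eq_fun do rewrite big_nil; exact: cmeas_cst.
by under eq_fun do rewrite big_cons; exact: cmeasD.
Qed.

Lemma cmeas_ccvg (h_ : nat -> R -> R[i]) h : (forall n, cmeas (h_ n)) ->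
  (forall x, 0 < x -> ccvg (h_ ^~ x) (h x)) -> cmeas h.
Proof.
move=> mh hh; split.
  apply: (@measurable_fun_cvg _ _ _ D (fun n x => complex.Re (h_ n x))).
    by move=> n; have [] := mh n.
  by move=> x; rewrite /= in_itv/= andbT => /hh/ccvg_Re.
apply: (@measurable_fun_cvg _ _ _ D (fun n x => complex.Im (h_ n x))).
  by move=> n; have [] := mh n.
by move=> x; rewrite /= in_itv/= andbT => /hh/ccvg_Im.
Qed.

(** Support interval and bound are explicit parameters because dominated convergence needs them
    uniform in n: its majorant is M times the indicator function of [al, be]. *)
Definition tame al be M h : Prop :=
  [/\ cmeas h, forall x, 0 < x -> nc (h x) <= M &
      forall x, 0 < x -> ~~ (al <= x <= be) -> h x = 0].

Lemma tameM al be M K g h : 0 <= K -> cmeas g ->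
  (forall x, 0 < x -> al <= x <= be -> nc (g x) <= K) ->
  tame al be M h -> tame al be (K * M) (fun x => g x * h x).
Proof.
move=> K0 mg gK [mh hM h0]; split; first exact: cmeasM.
  move=> x x0; have M0 : 0 <= M by exact: le_trans (normc_ge0 _) (hM x x0).
  have [xI|xI] := boolP (al <= x <= be); last first.
    by rewrite h0// mulr0 Normc.normc0 mulr_ge0.
  by rewrite Normc.normcM ler_pM ?normc_ge0 ?gK ?hM.
by move=> x x0 xI; rewrite h0// mulr0.
Qed.

Lemma tame_sum al be (I : Type) (s : seq I) (M : I -> R) (h : I -> R -> R[i]) :
  (forall i, tame al be (M i) (h i)) ->
  tame al be (\sum_(i <- s) M i) (fun x => \sum_(i <- s) h i x).
Proof.
move=> th; split.
- by apply: cmeas_sum => i; have [] := th i.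
- move=> x x0; rewrite (le_trans (normc_sum _ _ _))//; apply: ler_sum => i _.
  by have [_ + _] := th i; apply.
- by move=> x x0 xI; rewrite big1// => i _; have [_ _ ->] := th i.
Qed.

Lemma tame_integrable al be M h : tame al be M h ->
  mu.-integrable D (EFin \o (fun x => complex.Re (h x))) /\
  mu.-integrable D (EFin \o (fun x => complex.Im (h x))).
Proof.
move=> [[m1 m2] hM h0].
have M0 : 0 <= M by exact: le_trans (normc_ge0 _) (hM 1 ltr01).
have ig : mu.-integrable D (fun x => (M%:E * (\1_(`[al, be]%classic : set R) x)%:E)%E).
  apply: integrableZl => //; apply: (@integrableS _ _ _ _ setT) => //.
  exact: integrable_indic_itv.
have dom (p : R -> R) : (forall x, `|p x| <= nc (h x)) ->
    forall x, D x -> (`|(EFin \o p) x| <= `|M%:E * (\1_(`[al, be]%classic : set R) x)%:E|)%E.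
  move=> ph x Dx; have x0 : 0 < x by move: Dx; rewrite /= in_itv/= andbT.
  rewrite -EFinM !abse_EFin lee_fin indicE.
  have [xI|xI] := boolP (x \in (`[al, be]%classic : set R)).
    by rewrite mulr1 (le_trans (ph x))// (le_trans (hM _ x0))// ler_norm.
  rewrite mulr0 normr0 (le_trans (ph x))// h0// ?Normc.normc0//.
  by apply: contra xI => xI; rewrite inE/= in_itv.
split; apply: le_integrable ig => //.
- exact/measurable_EFinP.
- by apply: dom => x; exact: norm_Re_le.
- exact/measurable_EFinP.
- by apply: dom => x; exact: norm_Im_le.
Qed.

Lemma cintegralD al be M M' h g : tame al be M h -> tame al be M' g ->
  cintegral D (fun x => h x + g x) = cintegral D h + cintegral D g.
Proof.
move=> /tame_integrable[h1 h2] /tame_integrable[g1 g2]; apply: complex_ext.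
  rewrite ReD !Re_mk; under eq_Rintegral do rewrite ReD.
  exact: RintegralD.
rewrite ImD !Im_mk; under eq_Rintegral do rewrite ImD.
exact: RintegralD.
Qed.

Lemma cintegralZ al be M h c : tame al be M h ->
  cintegral D (fun x => c * h x) = c * cintegral D h.
Proof.
move=> /tame_integrable[h1 h2].
have Z1 (r : R) : mu.-integrable D (EFin \o (fun x => r * complex.Re (h x))).
  by apply: (@integrableZl _ _ _ mu D _ r _ h1); exact: measurable_itv.
have Z2 (r : R) : mu.-integrable D (EFin \o (fun x => r * complex.Im (h x))).
  by apply: (@integrableZl _ _ _ mu D _ r _ h2); exact: measurable_itv.
apply: complex_ext.
  rewrite ReM !(Re_mk, Im_mk); under eq_Rintegral do rewrite ReM.
  by rewrite RintegralB// !RintegralZl.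
rewrite ImM !(Re_mk, Im_mk); under eq_Rintegral do rewrite ImM.
by rewrite RintegralD// !RintegralZl.
Qed.

Lemma eq_cintegral h g : (forall x, 0 < x -> h x = g x) -> cintegral D h = cintegral D g.
Proof.
move=> hg; have e x : x \in D -> h x = g x.
  by rewrite inE/= in_itv/= andbT => /hg.
by congr (_ +i* _); apply: eq_Rintegral => x /e ->.
Qed.

Lemma cintegral0 : cintegral D (fun=> 0) = 0.
Proof. by apply: complex_ext; rewrite /= /Rintegral integral0. Qed.

Lemma cintegral_sum al be (I : Type) (s : seq I) (M : I -> R) (h : I -> R -> R[i]) :
  (forall i, tame al be (M i) (h i)) ->
  cintegral D (fun x => \sum_(i <- s) h i x) = \sum_(i <- s) cintegral D (h i).
Proof.
move=> th; elim: s => [|i s ih].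
  by rewrite big_nil -[RHS]cintegral0; congr cintegral; apply/funext => x; rewrite big_nil.
rewrite big_cons -ih -(cintegralD (th i) (tame_sum s th)).
by congr cintegral; apply/funext => x; rewrite big_cons.
Qed.

(** The exceptional point [x0] accommodates the jump of an indicator function, where the
    approximating polynomials need not converge to it. *)
Lemma cintegral_dct al be M M' (h_ : nat -> R -> R[i]) h (x0 : R) :
  (forall n, tame al be M (h_ n)) -> tame al be M' h ->
  (forall x, 0 < x -> x != x0 -> ccvg (h_ ^~ x) (h x)) ->
  ccvg (fun n => cintegral D (h_ n)) (cintegral D h).
Proof.
move=> th_ th hh.
have M0 : 0 <= M by have [_ /(_ 1 ltr01) + _] := th_ 0%N; exact: le_trans (normc_ge0 _).
have [ih1 ih2] := tame_integrable th.
have ig : mu.-integrable D (fun x => (M%:E * (\1_(`[al, be]%classic : set R) x)%:E)%E).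
  apply: integrableZl => //; apply: (@integrableS _ _ _ _ setT) => //.
  exact: integrable_indic_itv.
have dom n (p : R -> R) : (forall x, `|p x| <= nc (h_ n x)) ->
    forall x, D x -> (`|(EFin \o p) x| <= M%:E * (\1_(`[al, be]%classic : set R) x)%:E)%E.
  move=> ph x Dx; have xp : 0 < x by move: Dx; rewrite /= in_itv/= andbT.
  rewrite -EFinM !abse_EFin lee_fin indicE; have [_ hM h0] := th_ n.
  have [xI|xI] := boolP (x \in (`[al, be]%classic : set R)).
    by rewrite mulr1 (le_trans (ph x))// hM.
  rewrite mulr0 (le_trans (ph x))// h0// ?Normc.normc0//.
  by apply: contra xI => xI; rewrite inE/= in_itv.
have ae (f_ : nat -> R -> R) (f : R -> R) :
    (forall x, 0 < x -> x != x0 -> f_ n x @[n --> \oo] --> f x) ->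
    {ae mu, forall x, D x -> (f_ n x)%:E @[n --> \oo] --> (f x)%:E}.
  move=> ff; exists [set x0]; split => //; first exact: lebesgue_measure_set1.
  move=> x /= nx; apply: contrapT => xx0; apply: nx.
  rewrite in_itv/= andbT => xp; apply: cvg_EFin; first exact: nearW.
  by apply: ff => //; apply/eqP.
have lim (f_ : nat -> R -> R) (f : R -> R) :
    (forall n, measurable_fun D (f_ n)) -> mu.-integrable D (EFin \o f) ->
    (forall n x, `|f_ n x| <= nc (h_ n x)) ->
    (forall x, 0 < x -> x != x0 -> f_ n x @[n --> \oo] --> f x) ->
    (\int[mu]_(x in D) f_ n x)%R @[n --> \oo] --> (\int[mu]_(x in D) f x)%R.
  move=> mf_ if_ fn ff; apply: fine_cvg; rewrite fineK; last exact: integrable_fin_num.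
  have mE n : measurable_fun D (fun x => (f_ n x)%:E) by exact/measurable_EFinP.
  have aed : {ae mu, forall x n, D x ->
      (`|(f_ n x)%:E| <= M%:E * (\1_(`[al, be]%classic : set R) x)%:E)%E}.
    by apply: aeW => x n; exact: (dom n).
  have := @dominated_convergence _ _ _ mu D _ (fun n x => (f_ n x)%:E) (EFin \o f)
    _ _ _ (ae _ _ ff) ig aed.
  by move=> /(_ (measurable_itv _) mE (measurable_int mu if_))[].
apply: ccvg_ReIm; rewrite ?Re_mk ?Im_mk.
  apply: lim => //.
  - by move=> n; have [[]] := th_ n.
  - by move=> n x; exact: norm_Re_le.
  - by move=> x xp xn; apply: ccvg_Re; exact: hh.
apply: lim => //.
- by move=> n; have [[]] := th_ n.
- by move=> n x; exact: norm_Im_le.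
- by move=> x xp xn; apply: ccvg_Im; exact: hh.
Qed.

(** The real and imaginary parts of the average of [h] over [B] are each within e of those of [v],
    hence the factor 2. *)
Lemma cintegral_near_cst (B : set R) al be M h (v : R[i]) (e d : R) :
  measurable B -> B `<=` D -> mu B = d%:E -> 0 <= e ->
  tame al be M h -> (forall x, B x -> nc (h x - v) <= e) ->
  nc (cintegral D (fun x => (\1_B x)%:C * h x) - d%:C * v) <= 2 * e * d.
Proof.
move=> mB BD mBd e0 th hv; have [i1 i2] := tame_integrable th.
have key (f : R -> R) (w : R) : mu.-integrable D (EFin \o f) ->
   (forall x, B x -> `|f x - w| <= e) ->
   `|(\int[mu]_(x in D) (\1_B x * f x))%R - d * w| <= e * d.
  move=> jf fw; have jB : mu.-integrable B (EFin \o f) by exact: integrableS jf.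
  have jc (c : R) : mu.-integrable B (EFin \o (fun=> c)).
    apply: (@measurable_bounded_integrable _ _ _ mu (fun=> c)) => //.
      by have : (mu B < +oo)%E by rewrite mBd ltry.
    by exists `|c|; split => // x cx y _; exact: ltW.
  have -> : (\int[mu]_(x in D) (\1_B x * f x))%R = (\int[mu]_(x in B) f x)%R.
    rewrite Rintegral_mkcond [RHS]Rintegral_mkcond; congr Rintegral; apply/funext => x.
    rewrite /patch indicE; have [xB|xB] := boolP (x \in B).
      by rewrite mul1r ifT// inE; apply: BD; exact: set_mem.
    by rewrite mul0r; case: ifP.
  have -> : d * w = (\int[mu]_(x in B) w)%R.
    transitivity (w * fine (mu B)); first by rewrite mBd/= mulrC.
    exact/esym/Rintegral_cst.
  have jBw : mu.-integrable B (EFin \o (fun x => f x - w)).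
    exact: (@integrableB _ _ _ mu B mB _ _ jB (jc w)).
  rewrite -RintegralB//; apply: (le_trans (@le_normr_Rintegral _ _ _ mu B _ mB jBw)).
  have -> : e * d = (\int[mu]_(x in B) e)%R.
    transitivity (e * fine (mu B)); first by rewrite mBd.
    exact/esym/Rintegral_cst.
  apply: le_Rintegral => //.
  exact: (integrable_norm jBw).
rewrite (le_trans (normc_le_ReIm _))// -mulrA mulr2n mulrDl mul1r lerD//.
  have e1 : complex.Re (cintegral D (fun x => (\1_B x)%:C * h x)) =
      (\int[mu]_(x in D) (\1_B x * complex.Re (h x)))%R.
    by apply: eq_Rintegral => x _; rewrite ReM Re_real Im_real mul0r subr0.
  rewrite ReD ReN e1 ReM Re_real Im_real mul0r subr0.
  apply: key => // x Bx; apply: le_trans (hv _ Bx).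
  by have := norm_Re_le (h x - v); rewrite ReD ReN.
have e2 : complex.Im (cintegral D (fun x => (\1_B x)%:C * h x)) =
    (\int[mu]_(x in D) (\1_B x * complex.Im (h x)))%R.
  by apply: eq_Rintegral => x _; rewrite ImM Re_real Im_real mul0r addr0.
rewrite ImD ImN e2 ImM Re_real Im_real mul0r addr0.
apply: key => // x Bx; apply: le_trans (hv _ Bx).
by have := norm_Im_le (h x - v); rewrite ImD ImN.
Qed.

End TameFunctions.

(** * Step polynomials and moments *)

Section StepPolynomials.
Variable R : realType.
Implicit Types (x u : R) (N n m : nat).

Lemma bernoulli_sub x m : 0 <= x <= 1 -> 1 - m%:R * x <= (1 - x) ^+ m.
Proof.
move=> /andP[x0 x1]; elim: m => [|m ih]; first by rewrite mul0r subr0 expr0.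
rewrite exprS -natr1.
have h : (1 - x) * (1 - m%:R * x) <= (1 - x) * (1 - x) ^+ m by rewrite ler_wpM2l// subr_ge0.
apply: le_trans h; have : 0 <= m%:R * (x * x) by rewrite !mulr_ge0.
by lra.
Qed.

Lemma bernoulli_add x m : 0 <= x -> 1 + m%:R * x <= (1 + x) ^+ m.
Proof.
move=> x0; elim: m => [|m ih]; first by rewrite mul0r addr0 expr0.
rewrite exprS -natr1.
have h : (1 + x) * (1 + m%:R * x) <= (1 + x) * (1 + x) ^+ m by rewrite ler_wpM2l// addr_ge0.
apply: le_trans h; have : 0 <= m%:R * (x * x) by rewrite !mulr_ge0.
by lra.
Qed.

(* On [0, 1] these polynomials in u converge boundedly to the indicator function
   of u < 1/N, except at u = 1/N. *)
Definition step N n u : R := (1 - u ^+ n) ^+ (N ^ n).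

Lemma step_ge0 N n u : 0 <= u <= 1 -> 0 <= step N n u.
Proof.
by move=> /andP[u0 u1]; rewrite /step exprn_ge0// subr_ge0 exprn_ile1.
Qed.

Lemma step_le1 N n u : 0 <= u <= 1 -> step N n u <= 1.
Proof.
move=> /andP[u0 u1]; rewrite /step exprn_ile1//; first by rewrite subr_ge0 exprn_ile1.
by rewrite lerBlDr lerDl exprn_ge0.
Qed.

Lemma step_lower N n u : 0 <= u <= 1 -> 1 - (N%:R * u) ^+ n <= step N n u.
Proof.
move=> /andP[u0 u1]; rewrite exprMn -natrX; apply: bernoulli_sub.
by rewrite exprn_ge0//= exprn_ile1.
Qed.

(** With M = N^n, (1 - u^n)^M (1 + u^n)^M = (1 - u^(2n))^M <= 1, while (1 + u^n)^M >= M u^n by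
    Bernoulli: a device of elementary proofs of the Stone-Weierstrass theorem. *)
Lemma step_upper N n u : 0 <= u <= 1 -> step N n u * (N%:R * u) ^+ n <= 1.
Proof.
move=> u01; have s0 := step_ge0 N n u01; move: u01 => /andP[u0 u1].
apply: (@le_trans _ _ (step N n u * (1 + u ^+ n) ^+ (N ^ n))).
  rewrite ler_wpM2l// exprMn -natrX.
  by apply: le_trans (bernoulli_add _ (exprn_ge0 _ u0)); rewrite lerDr.
rewrite /step -exprMn -subr_sqr expr1n exprn_ile1//.
  by rewrite subr_ge0 -exprM exprn_ile1.
by rewrite lerBlDr lerDl sqr_ge0.
Qed.

Lemma step_cvg1 N u : 0 <= u <= 1 -> N%:R * u < 1 -> step N n u @[n --> \oo] --> (1 : R).
Proof.
move=> u01 Nu; have u0 : 0 <= N%:R * u by rewrite mulr_ge0//; case/andP: u01.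
have c : 1 - (N%:R * u) ^+ n @[n --> \oo] --> (1 - 0 : R).
  apply: cvgB; first exact: cvg_cst.
  by apply: cvg_expr; rewrite ger0_norm.
rewrite subr0 in c; apply: (squeeze_cvgr _ c (cvg_cst _)).
by apply: nearW => n; rewrite step_lower// step_le1.
Qed.

Lemma step_cvg0 N u : 0 <= u <= 1 -> 1 < N%:R * u -> step N n u @[n --> \oo] --> (0 : R).
Proof.
move=> u01 Nu; have Nu0 : 0 < N%:R * u by exact: lt_trans Nu.
have c : (N%:R * u)^-1 ^+ n @[n --> \oo] --> (0 : R).
  by apply: cvg_expr; rewrite ger0_norm ?invr_ge0 ?(ltW Nu0)// invf_lt1.
apply: (squeeze_cvgr _ (cvg_cst _) c); apply: nearW => n.
by rewrite step_ge0//= exprVn -div1r ler_pdivlMr ?exprn_gt0// step_upper.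
Qed.

End StepPolynomials.

(** * From equal moments to equal integrals over intervals, then to pointwise values *)

Section MomentTransfer.
Variable R : realType.
Local Notation mu := (@lebesgue_measure R).
Local Notation D := (`]0, +oo[%classic : set R).
Variables (al be M1 M2 : R) (G1 G2 : R -> R[i]).
Hypotheses (al0 : 0 < al) (be0 : 0 < be).
Hypotheses (t1 : tame al be M1 G1) (t2 : tame be^-1 al^-1 M2 G2).
Hypothesis moments : forall j : nat,
  cintegral D (fun t => (t ^+ j)%:C * G1 t) = cintegral D (fun t => (t^-1 ^+ j)%:C * G2 t).

Lemma measurable_invr_pos : measurable_fun D (fun t : R => t^-1).
Proof.
apply: open_continuous_measurable_fun => // x; rewrite inE/= in_itv/= andbT => x0.
by apply: inv_continuous; rewrite gt_eqF.
Qed.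

Lemma inv_support (x : R) : 0 < x -> be^-1 <= x <= al^-1 -> al <= x^-1 <= be.
Proof.
move=> x0 /andP[a b]; apply/andP; split.
  by rewrite -[al]invrK lef_pV2 ?posrE ?invr_gt0.
by rewrite -[be]invrK lef_pV2 ?posrE ?invr_gt0.
Qed.

Lemma poly_moments (p : {poly R}) :
  cintegral D (fun t => (p.[t])%:C * G1 t) = cintegral D (fun t => (p.[t^-1])%:C * G2 t).
Proof.
have b1 (j : nat) x : 0 < x -> al <= x <= be -> nc (x ^+ j)%:C <= be ^+ j.
  move=> x0 /andP[_ xb]; rewrite normc_real ger0_norm ?exprn_ge0 ?(ltW x0)//.
  by rewrite lerXn2r ?nnegrE ?(ltW x0) ?(ltW be0).
have T1 (j : nat) : tame al be (be ^+ j * M1) (fun t => (t ^+ j)%:C * G1 t).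
  apply: tameM t1; [by rewrite exprn_ge0// ltW| |exact: b1].
  by apply: cmeas_real; apply: measurable_funX; exact: measurable_id.
have T2 (j : nat) : tame be^-1 al^-1 (be ^+ j * M2) (fun t => (t^-1 ^+ j)%:C * G2 t).
  apply: tameM t2; [by rewrite exprn_ge0// ltW| |].
    by apply: cmeas_real; apply: measurable_funX; exact: measurable_invr_pos.
  by move=> x x0 xI; apply: b1; rewrite ?invr_gt0// inv_support.
have Z1 (j : nat) : tame al be (nc (p`_j)%:C * (be ^+ j * M1)) (fun t => (p`_j)%:C * ((t ^+ j)%:C * G1 t)).
  by apply: tameM (T1 j); [exact: normc_ge0|exact: cmeas_cst|].
have Z2 (j : nat) : tame be^-1 al^-1 (nc (p`_j)%:C * (be ^+ j * M2))
    (fun t => (p`_j)%:C * ((t^-1 ^+ j)%:C * G2 t)).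
  by apply: tameM (T2 j); [exact: normc_ge0|exact: cmeas_cst|].
transitivity (\sum_(j < size p) cintegral D (fun t => (p`_j)%:C * ((t ^+ j)%:C * G1 t))).
  rewrite -(cintegral_sum _ (fun j : 'I_(size p) => Z1 j)); apply: eq_cintegral => x _.
  rewrite horner_coef rmorph_sum/= mulr_suml; apply: eq_bigr => j _.
  by rewrite rmorphM mulrA.
transitivity (\sum_(j < size p) cintegral D (fun t => (p`_j)%:C * ((t^-1 ^+ j)%:C * G2 t))).
  apply: eq_bigr => j _; rewrite (cintegralZ _ (T1 j)) (cintegralZ _ (T2 j)).
  by rewrite moments.
rewrite -(cintegral_sum _ (fun j : 'I_(size p) => Z2 j)); apply: eq_cintegral => x _.
rewrite horner_coef rmorph_sum/= mulr_suml; apply: eq_bigr => j _.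
by rewrite rmorphM mulrA.
Qed.

Lemma tame_indic (B : set R) (a b M : R) G : measurable B -> tame a b M G ->
  tame a b M (fun t => (\1_B t)%:C * G t).
Proof.
move=> mB tG; rewrite -[M]mul1r; apply: tameM tG => //.
  by apply: cmeas_real; exact: measurable_indic.
by move=> x _ _; rewrite normc_real indicE; case: (_ \in _); rewrite ?normr1 ?normr0.
Qed.

Lemma ccvg_real (f : nat -> R) (l : R) (c : R[i]) : f n @[n --> \oo] --> l ->
  ccvg (fun n => (f n)%:C * c) (l%:C * c).
Proof.
move=> fl; apply: ccvg_ReIm.
  under eq_fun do rewrite ReM Re_real Im_real mul0r subr0.
  by rewrite ReM Re_real Im_real mul0r subr0; apply: cvgM => //; exact: cvg_cst.
under eq_fun do rewrite ImM Re_real Im_real mul0r addr0.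
by rewrite ImM Re_real Im_real mul0r addr0; apply: cvgM => //; exact: cvg_cst.
Qed.

Lemma moment_transfer (y : R) : 0 < y ->
  cintegral D (fun t => (\1_(`]-oo, y[%classic : set R) t)%:C * G1 t) =
  cintegral D (fun t => (\1_(`]y^-1, +oo[%classic : set R) t)%:C * G2 t).
Proof.
(* N y >= be puts c t = t/(N y) in [0, 1] for t on the support, and the threshold N c t = 1 is t =
   y. *)
move=> y0; pose N := (Num.truncn (be / y)).+1.
have Nbe : be <= N%:R * y.
  by rewrite -ler_pdivrMr// ltW// truncnS_gt.
have N0 : 0 < N%:R :> R by rewrite ltr0n.
have Ny : 0 < N%:R * y by rewrite mulr_gt0.
pose c := (N%:R * y)^-1.
have c0 : 0 < c by rewrite invr_gt0.
pose p n : {poly R} := (1 - (c *: 'X) ^+ n) ^+ (N ^ n).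
have pE n t : (p n).[t] = step N n (c * t).
  by rewrite /p /step !(horner_exp, hornerD, hornerN, hornerZ, hornerX, hornerC).
have unit t : 0 < t -> t <= be -> 0 <= c * t <= 1.
  move=> tp tb; rewrite mulr_ge0 ?(ltW tp) ?(ltW c0)//= mulrC ler_pdivrMr// mul1r.
  exact: le_trans Nbe.
have pm n : measurable_fun D (fun t => (p n).[t]).
  under [X in measurable_fun _ X]eq_fun do rewrite pE /step.
  apply: measurable_funX; apply: measurable_funB; first exact: measurable_cst.
  by apply: measurable_funX; apply: measurable_funM; [exact: measurable_cst|exact: measurable_id].
have pb n x : 0 < x -> al <= x <= be -> nc ((p n).[x])%:C <= 1.
  move=> x0 /andP[_ xb]; rewrite normc_real pE ger0_norm ?step_ge0 ?step_le1//; exact: unit.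
have T1 n : tame al be (1 * M1) (fun t => ((p n).[t])%:C * G1 t).
  by apply: tameM t1 => //; [exact: cmeas_real|exact: pb].
have T2 n : tame be^-1 al^-1 (1 * M2) (fun t => ((p n).[t^-1])%:C * G2 t).
  apply: tameM t2 => //; last first.
    by move=> x x0 xI; apply: pb; rewrite ?invr_gt0// inv_support.
  apply: cmeas_real; apply: (measurable_comp _ _ (pm n) measurable_invr_pos) => //.
  by move=> z [x /= x0 <-]; move: x0; rewrite !in_itv/= !andbT invr_gt0.
have lim (t : R) : 0 < t -> t <= be -> t != y ->
    (p n).[t] @[n --> \oo] --> (\1_(`]-oo, y[%classic : set R) t : R).
  move=> tp tb ty; under eq_fun do rewrite pE.
  have Nct : N%:R * (c * t) = t / y by rewrite /c; field; rewrite !gt_eqF.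
  rewrite indicE; have [ltty|leyt] := ltP t y.
    rewrite mem_set/= ?in_itv//=; apply: step_cvg1; first exact: unit.
    by rewrite Nct ltr_pdivrMr// mul1r.
  rewrite memNset/= ?in_itv/= -?leNgt//; last by apply/negP; rewrite -leNgt.
  apply: step_cvg0; first exact: unit.
  by rewrite Nct ltr_pdivlMr// mul1r lt_neqAle eq_sym ty.
have c1 := @cintegral_dct _ _ _ _ _ (fun n t => ((p n).[t])%:C * G1 t) _ y T1
  (tame_indic (measurable_itv `]-oo, y[) t1) _.
have c2 := @cintegral_dct _ _ _ _ _ (fun n t => ((p n).[t^-1])%:C * G2 t) _ y^-1 T2
  (tame_indic (measurable_itv `]y^-1, +oo[) t2) _.
apply: (ccvg_unique (c1 _)); last first.
  under eq_fun do rewrite poly_moments.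
  apply: c2 => t tp ty.
  (* The polynomials are controlled only on the support; off it both sides vanish. *)
  have [tI|tI] := boolP (be^-1 <= t <= al^-1); last first.
    have [_ _ ->//] := t2; under eq_fun do rewrite mulr0; rewrite mulr0; exact: cvg_cst.
  have /andP[_ tb] := inv_support tp tI.
  (* This replaces a change of variables: inversion exchanges the two half-lines, so the limit
     already found is evaluated at 1/t. *)
  have -> : \1_(`]y^-1, +oo[%classic : set R) t = \1_(`]-oo, y[%classic : set R) t^-1 :> R.
    rewrite !indicE; congr (_%:R); congr nat_of_bool; apply/idP/idP; rewrite !inE/= !in_itv/= ?andbT.
      by move=> yt; rewrite -[ltRHS]invrK ltf_pV2 ?posrE ?invr_gt0.
    by move=> yt; rewrite -[ltRHS]invrK ltf_pV2 ?posrE ?invr_gt0.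
  apply: ccvg_real; apply: lim => //; first by rewrite invr_gt0.
  by apply: contra ty => /eqP <-; rewrite invrK.
move=> t tp ty; have [tI|tI] := boolP (al <= t <= be); last first.
  have [_ _ ->//] := t1; under eq_fun do rewrite mulr0; rewrite mulr0; exact: cvg_cst.
by apply: ccvg_real; apply: lim => //; case/andP: tI.
Qed.

(** Differences of the half-lines of [moment_transfer]; inversion reverses the order of the ends,
    hence the opposite brackets. *)
Lemma moment_transfer_itv (p q : R) : 0 < p -> p < q ->
  cintegral D (fun t => (\1_(`[p, q[%classic : set R) t)%:C * G1 t) =
  cintegral D (fun t => (\1_(`]q^-1, p^-1]%classic : set R) t)%:C * G2 t).
Proof.
move=> p0 pq; have q0 : 0 < q by exact: lt_trans pq.
have diff (A B C : set R) (a b M : R) G : measurable A -> measurable B -> tame a b M G ->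
   (forall t, \1_C t = \1_A t - \1_B t :> R) ->
   cintegral D (fun t => (\1_C t)%:C * G t) =
   cintegral D (fun t => (\1_A t)%:C * G t) - cintegral D (fun t => (\1_B t)%:C * G t).
  move=> mA mB tG CE.
  have tB : tame a b (nc (-1) * M) (fun t => (-1) * ((\1_B t)%:C * G t)).
    by apply: tameM (tame_indic mB tG); [exact: normc_ge0|exact: cmeas_cst|].
  rewrite -mulN1r -(cintegralZ _ (tame_indic mB tG)) -(cintegralD (tame_indic mA tG) tB).
  by apply: eq_cintegral => t _; rewrite CE rmorphB/=; ring.
rewrite (diff `]-oo, q[%classic `]-oo, p[%classic _ _ _ _ _ _ _ t1)//; last first.
  move=> t; rewrite !indicE !mem_setE !in_itv/=.
  have [pt|tp] := leP p t => /=; first by rewrite subr0.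
  by rewrite (lt_trans tp pq) subrr.
rewrite (diff `]q^-1, +oo[%classic `]p^-1, +oo[%classic _ _ _ _ _ _ _ t2)//; last first.
  have pq' : q^-1 < p^-1 by rewrite ltf_pV2.
  move=> t; rewrite !indicE !mem_setE !in_itv/= !andbT.
  have [pt|tp] := leP t p^-1; rewrite ?andbT ?andbF ?subr0//.
  by rewrite (lt_trans pq' tp) subrr.
by rewrite !moment_transfer.
Qed.

(** Each integral over a short interval at y is compared with value times length. The lengths are s
    and s/(y w), w being the other endpoint, and w -> y leaves the Jacobian y^(-2) of inversion. One
    side of y is enough, as the functions may jump there. *)
Lemma moment_derivative (y : R) (v1 v2 : R[i]) (I : set R) (d0 : R) : 0 < y -> 0 < d0 ->
  (forall t, y <= t < y + d0 -> I t) \/ (forall t, y - d0 < t <= y -> I t) ->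
  (forall e : R, 0 < e -> exists2 d : R, 0 < d & forall t, 0 < t -> I t -> `|t - y| < d ->
     nc (G1 t - v1) <= e /\ nc (G2 t^-1 - v2) <= e) ->
  v1 = (y^-1 ^+ 2)%:C * v2.
Proof.
move=> y0 d00 HI Hv; apply/eqP; rewrite -subr_eq0 -normc_eq0; apply/eqP/le_anti.
rewrite normc_ge0 andbT; apply/ler_addgt0Pr => e e0; rewrite add0r.
(* Collects the constants of [k4] and [k5]: 2 + 4 y^(-2) from averaging, 2 y^(-3)|v2| from replacing
   w by y. *)
pose K : R := 2 + 4 * y^-1 ^+ 2 + 2 * y^-1 ^+ 3 * nc v2.
have K0 : 0 < K.
  by rewrite /K -addrA ltr_wpDr// addr_ge0 ?mulr_ge0 ?exprn_ge0 ?normc_ge0// invr_ge0 ltW.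
pose e' := e / K; have e'0 : 0 < e' by rewrite divr_gt0.
have [d d_gt0 Hd] := Hv _ e'0.
pose s := Num.min (Num.min (d0 / 2) (d / 2)) (Num.min (y / 2) e').
have s0 : 0 < s by rewrite !lt_min !divr_gt0.
have sd0 : s <= d0 / 2 by rewrite !ge_min lexx.
have sd : s <= d / 2 by rewrite !ge_min lexx orbT.
have sy : s <= y / 2 by rewrite !ge_min lexx !orbT.
have se : s <= e' by rewrite !ge_min lexx !orbT.
(* The interval starts or ends at y; both cases are summed up by p q = y w, where w = p + q - y is
   the other endpoint. The bound s <= y/2 keeps w away from 0. *)
have [p [q [pq qp py qy H]]] : exists p q : R, [/\ q - p = s, p * q = y * (p + q - y),
    y / 2 <= p, y / 2 <= p + q - y & forall t, p <= t < q -> I t /\ `|t - y| < d].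
  case: HI => HI.
    exists y, (y + s); split; [by ring|by ring|lra|lra|].
    move=> t /andP[a b]; split; first by apply: HI; rewrite a/=; lra.
    by rewrite ger0_norm; lra.
  exists (y - s), y; split; [by ring|by ring|lra|lra|].
  move=> t /andP[a b]; split; first by apply: HI; rewrite (ltW b) andbT; lra.
  by rewrite ler0_norm; lra.
have p0 : 0 < p by lra.
have pltq : p < q by lra.
have q0 : 0 < q by exact: lt_trans pltq.
pose w := p + q - y; have w0 : 0 < w by rewrite /w; lra.
have iq : q^-1 < p^-1 by rewrite ltf_pV2.
have len : p^-1 - q^-1 = s / (y * w).
  by rewrite -qp -pq; field; rewrite !gt_eqF.
have m1 : mu `[p, q[%classic = s%:E.
  by rewrite lebesgue_measure_itv/= lte_fin pltq -EFinB pq.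
have m2 : mu `]q^-1, p^-1]%classic = (s / (y * w))%:E.
  by rewrite lebesgue_measure_itv/= lte_fin iq -EFinB len.
have k1 := @cintegral_near_cst _ `[p, q[%classic al be M1 G1 v1 e' s (measurable_itv _) _ m1 (ltW e'0) t1 _.
have k2 := @cintegral_near_cst _ `]q^-1, p^-1]%classic be^-1 al^-1 M2 G2 v2 e' _ (measurable_itv _) _ m2 (ltW e'0) t2 _.
have {}k1 : nc (cintegral D (fun t => (\1_(`[p, q[%classic : set R) t)%:C * G1 t) - s%:C * v1)
    <= 2 * e' * s.
  apply: k1 => t /=; rewrite !in_itv/=.
    by move=> /andP[a _]; rewrite andbT; exact: lt_le_trans a.
  move=> a; have [b c] := H _ a; have [] := Hd t _ b c => //.
  by case/andP: a => a _; exact: lt_le_trans a.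
have {}k2 : nc (cintegral D (fun t => (\1_(`]q^-1, p^-1]%classic : set R) t)%:C * G2 t) -
    (s / (y * w))%:C * v2) <= 2 * e' * (s / (y * w)).
  apply: k2 => t /=; rewrite !in_itv/=.
    by move=> /andP[a _]; rewrite andbT; apply: lt_trans a; rewrite invr_gt0.
  move=> /andP[a b]; have tp : 0 < t by apply: lt_trans a; rewrite invr_gt0.
  have a' : p <= t^-1 < q.
    rewrite -[X in X <= _]invrK lef_pV2 ?posrE ?invr_gt0// b/=.
    by rewrite -[ltRHS]invrK ltf_pV2 ?posrE ?invr_gt0.
  have tip : 0 < t^-1 by rewrite invr_gt0.
  by have [b' c] := H _ a'; have [_] := Hd t^-1 tip b' c; rewrite invrK.
rewrite moment_transfer_itv// in k1.
set X := cintegral _ _ in k1 k2.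
have k3 : nc (s%:C * v1 - (s / (y * w))%:C * v2) <= 2 * e' * s + 2 * e' * (s / (y * w)).
  have -> : s%:C * v1 - (s / (y * w))%:C * v2 =
    (X - (s / (y * w))%:C * v2) - (X - s%:C * v1) by ring.
  by rewrite (le_trans (normcB _ _))// addrC lerD.
have iw : w^-1 <= 2 * y^-1.
  by rewrite -[2]invrK -invfM lef_pV2 ?posrE ?mulr_gt0 ?invr_gt0// mulrC.
have yi : 0 < y^-1 by rewrite invr_gt0.
have k4 : nc (v1 - ((y * w)^-1)%:C * v2) <= 2 * e' + 2 * e' * (y * w)^-1.
  rewrite -(ler_pM2l s0) -[X in X * _ <= _](gtr0_norm s0) -normc_real -Normc.normcM.
  rewrite mulrBr mulrA -rmorphM/=; apply: le_trans k3 _.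
  by rewrite le_eqVlt; apply/orP; left; apply/eqP; field; rewrite !gt_eqF.
have wy : w - y = s \/ w - y = - s.
  suff : (w - y - s) * (w - y + s) = 0.
    by move/eqP; rewrite mulf_eq0 subr_eq0 addr_eq0 => /orP[] /eqP; [left|right].
  rewrite /w -pq.
  have -> : (p + q - y - y - (q - p)) * (p + q - y - y + (q - p)) =
    4 * (p * q - y * (p + q - y)) by ring.
  by rewrite qp subrr mulr0.
have k5 : nc ((y^-1 ^+ 2)%:C * v2 - ((y * w)^-1)%:C * v2) <= s * (2 * y^-1 ^+ 3) * nc v2.
  rewrite -mulrBl -rmorphB/= Normc.normcM normc_real ler_wpM2r ?normc_ge0//.
  have -> : y^-1 ^+ 2 - (y * w)^-1 = (w - y) * (y^-1 ^+ 2 * w^-1).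
    by field; rewrite !gt_eqF.
  rewrite normrM.
  have -> : `|w - y| = s by case: wy => ->; rewrite ?normrN gtr0_norm.
  rewrite ler_pM2l// ger0_norm ?mulr_ge0 ?exprn_ge0 ?invr_ge0 ?(ltW y0) ?(ltW w0)//.
  have -> : 2 * y^-1 ^+ 3 = y^-1 ^+ 2 * (2 * y^-1) by ring.
  by rewrite ler_wpM2l// exprn_ge0// ltW.
have -> : v1 - (y^-1 ^+ 2)%:C * v2 = (v1 - ((y * w)^-1)%:C * v2) -
  ((y^-1 ^+ 2)%:C * v2 - ((y * w)^-1)%:C * v2) by ring.
rewrite (le_trans (normcB _ _))//.
have -> : e = e' * 2 + e' * (4 * y^-1 ^+ 2) + e' * (2 * y^-1 ^+ 3 * nc v2).
  by rewrite -!mulrDr divfK ?gt_eqF.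
apply: (le_trans (lerD k4 k5)); apply: lerD; last first.
  rewrite -mulrA ler_wpM2r//.
  by rewrite !mulr_ge0 ?exprn_ge0 ?normc_ge0// ltW.
rewrite (mulrC 2 e') lerD2l -mulrA ler_wpM2l ?(ltW e'0)// invfM.
have -> : 4 * y^-1 ^+ 2 = 2 * (y^-1 * (2 * y^-1)) by ring.
by rewrite ler_wpM2l// ler_wpM2l// ltW.
Qed.

End MomentTransfer.

(** * Test functions *)

Section PathContinuity.
Variable R : realType.
Implicit Types (h g : R -> R[i]) (y : R).

Definition ccont h y : Prop :=
  {for y, continuous (fun t => complex.Re (h t))} /\
  {for y, continuous (fun t => complex.Im (h t))}.

Lemma ccontP h y : ccont h y -> forall e : R, 0 < e ->
  exists2 d : R, 0 < d & forall t, `|t - y| < d -> nc (h t - h y) <= e.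
Proof.
move=> [/cvgrPdist_lt c1 /cvgrPdist_lt c2] e e0.
have e2 : 0 < e / 2 by rewrite divr_gt0.
have /nbhs_ballP[d1 /= d10 H1] := c1 _ e2.
have /nbhs_ballP[d2 /= d20 H2] := c2 _ e2.
exists (Num.min d1 d2); first by rewrite lt_min d10.
move=> t; rewrite lt_min => /andP[t1 t2].
have b1 : ball y d1 t by rewrite /ball/= distrC.
have b2 : ball y d2 t by rewrite /ball/= distrC.
have := H1 _ b1; have := H2 _ b2 => /= h2 h1.
rewrite (le_trans (normc_le_ReIm _))// !ReImE (splitr e) ltW// ltrD// distrC//.
Qed.

Lemma ccont_eps h y : (forall e : R, 0 < e ->
  exists2 d : R, 0 < d & forall t, `|t - y| < d -> nc (h t - h y) <= e) -> ccont h y.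
Proof.
move=> H; split; apply/cvgrPdist_le => e e0; have [d d0 Hd] := H _ e0.
  apply/nbhs_ballP; exists d => // t; rewrite /ball/= distrC => /Hd; apply: le_trans.
  by rewrite distrC; have := norm_Re_le (h t - h y); rewrite !ReImE.
apply/nbhs_ballP; exists d => // t; rewrite /ball/= distrC => /Hd; apply: le_trans.
by rewrite distrC; have := norm_Im_le (h t - h y); rewrite !ReImE.
Qed.

Lemma ccont_cst c y : ccont (fun=> c) y.
Proof. by split; exact: cvg_cst. Qed.

Lemma ccont_real (f : R -> R) y : {for y, continuous f} -> ccont (fun t => (f t)%:C) y.
Proof. by move=> cf; split => //; exact: cvg_cst. Qed.

Lemma ccont_imag (f : R -> R) y : {for y, continuous f} -> ccont (fun t => (f t)*i) y.
Proof. by move=> cf; split => //; exact: cvg_cst. Qed.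

Lemma ccontM h g y : ccont h y -> ccont g y -> ccont (fun t => h t * g t) y.
Proof.
move=> [h1 h2] [g1 g2]; split.
  rewrite (_ : (fun t => complex.Re (h t * g t)) =
    (fun t => complex.Re (h t) * complex.Re (g t) - complex.Im (h t) * complex.Im (g t))).
    by apply: cvgB; apply: cvgM.
  by apply/funext => t; rewrite ReM.
rewrite (_ : (fun t => complex.Im (h t * g t)) =
    (fun t => complex.Re (h t) * complex.Im (g t) + complex.Im (h t) * complex.Re (g t))).
  by apply: cvgD; apply: cvgM.
by apply/funext => t; rewrite ImM.
Qed.

Lemma ccontD h g y : ccont h y -> ccont g y -> ccont (fun t => h t + g t) y.
Proof.
move=> [h1 h2] [g1 g2]; split.
  rewrite (_ : (fun t => complex.Re (h t + g t)) =
    (fun t => complex.Re (h t) + complex.Re (g t))); first by apply: cvgD.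
  by apply/funext => t; rewrite ReD.
rewrite (_ : (fun t => complex.Im (h t + g t)) =
    (fun t => complex.Im (h t) + complex.Im (g t))); first by apply: cvgD.
by apply/funext => t; rewrite ImD.
Qed.

Lemma ccont_sum (I : Type) (s : seq I) (h : I -> R -> R[i]) y :
  (forall i, ccont (h i) y) -> ccont (fun t => \sum_(i <- s) h i t) y.
Proof.
move=> ch; elim: s => [|i s ih].
  rewrite (_ : (fun t => _) = fun=> 0); first exact: ccont_cst.
  by apply/funext => t; rewrite big_nil.
rewrite (_ : (fun t => _) = fun t => h i t + \sum_(j <- s) h j t); first exact: ccontD.
by apply/funext => t; rewrite big_cons.
Qed.

Lemma ccont_jet2 (F : R[i] -> R[i]) h y : ccont h y -> jet2 F (h y) ->
  ccont (fun t => F (h t)) y.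
Proof.
move=> ch /jet2_lipschitz[L [r [L0 /andP[r0 r1] H]]]; apply: ccont_eps => e e0.
have m0 : 0 < Num.min (r / 2) (e / L) by rewrite lt_min !divr_gt0.
have [d d0 Hd] := ccontP ch m0; exists d => // t /Hd; rewrite le_min => /andP[a b].
have -> : h t = h y + (h t - h y) by ring.
have ar : nc (h t - h y) < r by lra.
apply: (le_trans (H _ ar)); rewrite mulrC -ler_pdivlMr//.
Qed.

Lemma smooth_ccont g y : smooth g -> ccont g y.
Proof.
move=> sg; have [dR dI] := sg 0%N y.
by split; apply: differentiable_continuous; exact/derivable1_diffP.
Qed.

Lemma powR_continuous (s y : R) : 0 < y -> {for y, continuous (fun t : R => t `^ s)}.
Proof.
move=> y0; apply: differentiable_continuous; apply/derivable1_diffP.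
by have [] := is_derive1_powR s y0.
Qed.

End PathContinuity.

Section TestFunctions.
Variable R : realType.
Implicit Types phi : R -> R[i].

Local Notation D := (`]0, +oo[%classic : set R).

Lemma smooth_bounded (g : R -> R[i]) (a b : R) : smooth g ->
  exists2 M : R, 0 <= M & forall x, a <= x <= b -> nc (g x) <= M.
Proof.
move=> sg; have [ab|ba] := leP a b; last first.
  by exists 0 => // x /andP[ax xb]; have := le_trans ax xb; rewrite leNgt ba.
have bnd (f : R -> R) : continuous f -> exists2 M : R, 0 <= M & forall x, a <= x <= b -> `|f x| <= M.
  move=> cf.
  have cn : {within `[a, b], continuous (fun x => `|f x|)}.
    by apply: continuous_subspaceT => x; apply: cvg_norm; exact: cf.
  have [c _ Hc] := EVT_max ab cn.
  by exists `|f c| => // x xab; apply: Hc; rewrite in_itv.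
have [M1 M10 H1] := bnd _ (fun x => (smooth_ccont x sg).1).
have [M2 M20 H2] := bnd _ (fun x => (smooth_ccont x sg).2).
exists (M1 + M2); first by rewrite addr_ge0.
by move=> x xab; rewrite (le_trans (normc_le_ReIm _))// lerD ?H1 ?H2.
Qed.

Lemma piecewise_smooth_cmeas phi : piecewise_smooth phi -> cmeas phi.
Proof.
move=> [N [I [g [_ sg phig cov]]]].
(* Pieces are indexed by [nat] to use countable unions; from index [N] on they are empty. *)
pose E (k : nat) : set R := [set x | 0 < x /\ exists2 i : 'I_N, nat_of_ord i = k & x \in I i].
have DE : D = \bigcup_k E k.
  apply/seteqP; split => [x|x [k _ [x0 _]]]; rewrite /= in_itv/= andbT// => x0.
  by have [i xi] := cov x x0; exists (nat_of_ord i) => //; split => //; exists i.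
have Ecase k : (exists2 i : 'I_N, nat_of_ord i = k & E k = D `&` [set` I i]) \/ E k = set0.
  have [kN|kN] := ltnP k N; [left|right].
    exists (Ordinal kN) => //; apply/seteqP; split => x /=.
      move=> [x0 [i ik xi]]; rewrite in_itv/= andbT; split => //.
      by have -> : Ordinal kN = i by apply/val_inj.
    by rewrite in_itv/= andbT => -[x0 xi]; split => //; exists (Ordinal kN).
  by apply/seteqP; split => x //= [_ [i ik _]]; have := ltn_ord i; rewrite ik ltnNge kN.
have mE k : measurable (E k).
  have [[i _ ->]|->] := Ecase k; last exact: measurable0.
  by apply: measurableI; exact: measurable_itv.
have key (f : R -> R) (f' : 'I_N -> R -> R) : (forall i, continuous (f' i)) ->
    (forall i x, x \in I i -> f x = f' i x) -> measurable_fun D f.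
  move=> cf' ff'; rewrite DE; apply/(measurable_fun_bigcup _ mE) => k.
  have [[i _ ->]|->] := Ecase k; last exact: measurable_fun_set0.
  apply: (@eq_measurable_fun _ _ _ _ _ (f' i)).
    by move=> x; rewrite inE/= => -[_ /ff'].
  by apply: measurable_funTS; apply: continuous_measurable_fun; exact: cf'.
split.
  apply: (key _ (fun i x => complex.Re (g i x))).
    by move=> i x; have [] := smooth_ccont x (sg i).
  by move=> i x /phig ->.
apply: (key _ (fun i x => complex.Im (g i x))).
  by move=> i x; have [] := smooth_ccont x (sg i).
by move=> i x /phig ->.
Qed.

Lemma piecewise_smooth_tame phi : compactly_supported phi -> piecewise_smooth phi ->
  exists al be M : R, [/\ 0 < al, 0 < be & tame al be M phi].
Proof.
move=> [a [b [a0 phi0]]] ps.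
have mphi := piecewise_smooth_cmeas ps; move: ps => [N [I [g [_ sg phig cov]]]].
have /choice[M HM] : forall i : 'I_N, exists M : R, 0 <= M /\ forall x, a <= x <= b -> nc (g i x) <= M.
  by move=> i; have [M M0 H] := smooth_bounded a b (sg i); exists M.
(* [b] may lie below [a], when [phi] vanishes identically; the maximum still gives a positive right
   end. *)
exists a, (Num.max a b), (\sum_i M i); split => //; first by rewrite lt_max a0.
have S0 : 0 <= \sum_i M i by apply: sumr_ge0 => i _; have [] := HM i.
split => // x x0; last first.
  move=> xI; apply: phi0; apply: contra xI => /andP[ax xb].
  by rewrite ax le_max xb orbT.
have [xI|xI] := boolP (a <= x <= b); last by rewrite phi0// Normc.normc0.
have [i xi] := cov x x0; rewrite (phig i)//.
rewrite (bigD1 i)//= (le_trans ((HM i).2 x xI))// lerDl.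
by apply: sumr_ge0 => j _; have [] := HM j.
Qed.

(** A piece containing y is a nondegenerate interval, so it extends from y to at least one side. *)
Lemma piecewise_smooth_germ phi (y : R) : piecewise_smooth phi -> 0 < y ->
  exists (I : set R) (g : R -> R[i]) (d : R),
    [/\ smooth g, 0 < d, phi y = g y, forall t, I t -> phi t = g t &
        (forall t, y <= t < y + d -> I t) \/ (forall t, y - d < t <= y -> I t)].
Proof.
move=> [N [I [g [nI sg phig cov]]]] y0; have [i yi] := cov y y0.
have conv (u v t : R) : u \in I i -> v \in I i -> u <= t <= v -> t \in I i.
  by move=> ui vi utv; apply: (@interval_is_interval _ (I i) u v ui vi t).
have [x1 [x2 [x1i x2i x12]]] := nI i.
have [yx2|x2y] := ltP y x2.
  exists [set` I i], (g i), (x2 - y); split => //; [by rewrite subr_gt0|exact: phig|exact: phig|].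
  left => t /andP[a b]; apply: (conv y x2) => //; rewrite a/=; lra.
exists [set` I i], (g i), (y - x1); split => //; [by lra|exact: phig|exact: phig|].
right => t /andP[a b]; apply: (conv x1 y) => //; rewrite b andbT; lra.
Qed.

Lemma powR_bounded (s a b : R) : 0 < a -> exists2 M : R, 0 <= M &
  forall x, a <= x <= b -> x `^ s <= M.
Proof.
move=> a0; have [ab|ba] := leP a b; last first.
  by exists 0 => // x /andP[ax xb]; have := le_trans ax xb; rewrite leNgt ba.
have cn : {within `[a, b], continuous (fun x : R => x `^ s)}.
  apply: continuous_in_subspaceT => x; rewrite inE/= in_itv/= => /andP[ax _].
  exact/powR_continuous/(lt_le_trans a0).
have [c _ Hc] := EVT_max ab cn.
by exists (c `^ s); [exact: powR_ge0|move=> x xab; apply: Hc; rewrite in_itv].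
Qed.

(** The S-transform of a test function need not belong to [Sc]; tameness is the property it
    inherits, inversion mapping [al, be] to [1/be, 1/al]. *)
Lemma slashS_tame (k : R) chi phi (al be M : R) : 0 < al -> 0 < be ->
  tame al be M phi -> exists M', tame be^-1 al^-1 M' (slashS k chi phi).
Proof.
move=> al0 be0 [[m1 m2] phiM phi0].
have [K K0 HK] := @powR_bounded (k - 2) be^-1 al^-1 ltac:(by rewrite invr_gt0).
have tinv : tame be^-1 al^-1 M (fun x => phi x^-1).
  have sub : [set x^-1 | x in D] `<=` D.
    by move=> z [x /= x0 <-]; move: x0; rewrite !in_itv/= !andbT invr_gt0.
  split.
  - split.
      exact: (measurable_comp (measurable_itv _) sub m1 (@measurable_invr_pos R)).
    exact: (measurable_comp (measurable_itv _) sub m2 (@measurable_invr_pos R)).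
  - by move=> x x0; apply: phiM; rewrite invr_gt0.
  - move=> x x0 xI; apply: phi0; first by rewrite invr_gt0.
    apply: contra xI => /andP[ax xb]; apply/andP; split.
      by rewrite -[x]invrK lef_pV2 ?posrE ?invr_gt0.
    by rewrite -[x]invrK lef_pV2 ?posrE ?invr_gt0.
exists (K * nc (chi matS) * M); apply: (tameM _ _ _ tinv).
- by rewrite mulr_ge0 ?normc_ge0.
- apply: cmeasM; last exact: cmeas_cst.
  by apply: cmeas_real; apply: measurable_funTS; exact: measurable_powR.
- move=> x x0 xI; rewrite Normc.normcM ler_pM ?normc_ge0// normc_real.
  by rewrite ger0_norm ?powR_ge0// HK.
Qed.

End TestFunctions.

(** * Termwise integration *)

Section LaplaceSeries.
Variable R : realType.
Local Notation D := (`]0, +oo[%classic : set R).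
Variables (b : nat -> R[i]) (lam : nat -> R) (Dl : R).
Hypotheses (sb : subexp b) (lD : forall l, `|lam l - 2 * pi * l%:R| <= Dl).

Definition fourier_sum (z : R[i]) : R[i] := limn (series (fterm b lam z : nat -> R[i]^o)).

(** On the imaginary axis the exponentials are real and become the kernel of the Laplace
    transform. *)
Lemma fterm_imag (t : R) l : fterm b lam t*i l = b l * (expR (- (lam l * t)))%:C.
Proof.
have e : (lam l)*i * t*i = (- (lam l * t))%:C.
  by apply: complex_ext; rewrite ?ReM ?ImM /=; ring.
by rewrite /fterm e /cexp Re_real Im_real cos0 sin0 -[1 +i* 0]/(1 : R[i]) mulr1.
Qed.

Lemma cmeas_expR (c : R) : cmeas (fun t : R => (expR (- (c * t)))%:C).
Proof.
apply: cmeas_real; under [X in measurable_fun _ X]eq_fun do rewrite -mulNr.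
apply: (@measurableT_comp _ _ _ _ _ _ (@expR R) D (fun t => - c * t)).
  exact: measurable_expR.
by apply: measurable_funM; [exact: measurable_cst|exact: measurable_id].
Qed.

Lemma fourier_path_bound (al be : R) : 0 < al -> 0 < be ->
  exists S : R, [/\ 0 <= S,
    forall n t, al <= t <= be -> nc (series (fterm b lam t*i : nat -> R[i]^o) n) <= S &
    forall t, al <= t <= be -> nc (fourier_sum t*i) <= S].
Proof.
move=> al0 be0; have D0 : 0 <= Dl by exact: le_trans (normr_ge0 _) (lD 0%N).
have c0 : 0 < 2 * pi * al by rewrite !mulr_gt0// pi_gt0.
(* For t in [al, be], lam t >= (2 pi l - Dl) t >= 2 pi al l - Dl be. *)
pose v l := expR (Dl * be) * (nc (b l) * expR (- (2 * pi * al * l%:R))).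
have cv : cvgn (series v) by exact: cvgP (@cvg_seriesMl _ (expR (Dl * be)) _ (subexp_cvg sb c0)).
have bd t : al <= t <= be -> forall l, nc (fterm b lam t*i l) <= v l.
  move=> /andP[at_ tb] l; have t0 : 0 < t by exact: lt_le_trans at_.
  rewrite fterm_imag Normc.normcM normc_real ger0_norm ?expR_ge0//.
  rewrite /v mulrCA ler_wpM2l ?normc_ge0// -expRD ler_expR.
  have := lD l; rewrite ler_norml => /andP[l1 _].
  have p1 : 0 <= (lam l - (2 * pi * l%:R - Dl)) * t by rewrite mulr_ge0 ?(ltW t0)//; lra.
  have p2 : 0 <= (2 * pi * l%:R) * (t - al) by rewrite mulr_ge0 ?subr_ge0// !mulr_ge0// pi_ge0.
  have p3 : 0 <= Dl * (be - t) by rewrite mulr_ge0// subr_ge0.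
  by lra.
exists `|limn (series v)|; split => //.
- move=> n t tI; apply: le_trans (ler_norm _).
  by apply: normc_series_le cv; exact: bd.
- move=> t tI; have [l hl hb] := dominated_csum (bd _ tI) cv.
  by rewrite /fourier_sum (csum_limn hl) (le_trans hb)// ler_norm.
Qed.

Lemma cmeas_fourier : cmeas (fun t => fourier_sum t*i).
Proof.
apply: (@cmeas_ccvg _ (fun n t => series (fterm b lam t*i : nat -> R[i]^o) n)).
  move=> n; apply: cmeas_sum => l.
  under eq_fun do rewrite fterm_imag.
  apply: cmeasM; first exact: cmeas_cst.
  exact: cmeas_expR.
by move=> x x0; exact: fterm_csum sb lD _.
Qed.

Lemma fourier_tame phi (al be M : R) : 0 < al -> 0 < be -> tame al be M phi ->
  exists M', tame al be M' (fun t => fourier_sum t*i * phi t).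
Proof.
move=> al0 be0 tp; have [S [S0 _ HS]] := fourier_path_bound al0 be0.
exists (S * M); apply: tameM tp => //; first exact: cmeas_fourier.
by move=> x _; exact: HS.
Qed.

(** Dominated convergence, the partial sums being uniformly bounded on the support of [phi]; it
    yields the convergence of the L-series together with its value. *)
Lemma laplace_csum phi (al be M : R) : 0 < al -> 0 < be -> tame al be M phi ->
  csum (fun l => b l * laplace phi (lam l)) (cintegral D (fun t => fourier_sum t*i * phi t)).
Proof.
move=> al0 be0 tp; have [S [S0 HS _]] := fourier_path_bound al0 be0.
have [M' tF] := fourier_tame al0 be0 tp.
have Tl l : tame al be (expR (`|lam l| * be) * M) (fun t => (expR (- (lam l * t)))%:C * phi t).
  apply: tameM tp; [exact: expR_ge0|exact: cmeas_expR|].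
  move=> x x0 /andP[_ xb]; rewrite normc_real ger0_norm ?expR_ge0// ler_expR.
  rewrite -mulNr (le_trans (ler_norm _))// normrM normrN (gtr0_norm x0).
  by rewrite ler_wpM2l.
have Zl l : tame al be (nc (b l) * (expR (`|lam l| * be) * M))
    (fun t => b l * ((expR (- (lam l * t)))%:C * phi t)).
  by apply: tameM (Tl l); [exact: normc_ge0|exact: cmeas_cst|].
rewrite /csum.
have -> : series ((fun l => b l * laplace phi (lam l)) : nat -> R[i]^o) =
    fun n => cintegral D (fun t => series (fterm b lam t*i : nat -> R[i]^o) n * phi t).
  apply/funext => n; rewrite /series/=.
  transitivity (\sum_(0 <= l < n) cintegral D (fun t => b l * ((expR (- (lam l * t)))%:C * phi t))).
    by apply: eq_bigr => l _; rewrite (cintegralZ _ (Tl l)).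
  rewrite -(cintegral_sum _ Zl); apply: eq_cintegral => t _.
  by rewrite mulr_suml; apply: eq_bigr => l _; rewrite fterm_imag mulrA.
(* The exceptional point 0 lies outside the domain of integration. *)
apply: (@cintegral_dct _ al be (S * M) M' _ _ 0) => //.
- move=> n; apply: tameM tp => //; last by move=> x _; exact: HS.
  apply: cmeas_sum => l; under eq_fun do rewrite fterm_imag.
  by apply: cmeasM; [exact: cmeas_cst|exact: cmeas_expR].
- move=> x x0 _.
  have h := @fterm_csum _ _ _ _ x*i sb lD x0.
  under eq_fun do rewrite mulrC.
  by rewrite mulrC; apply: ccvgZ.
Qed.

End LaplaceSeries.

(** * The modular group *)

Section ModularGroup.

Lemma mx2_eta (g : 'M[int]_2) : g = mx2 (g 0 0) (g 0 1) (g 1 0) (g 1 1).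
Proof.
apply/matrixP => i j; rewrite mxE.
case: (unliftP 0 i) => [i'|] ->; case: (unliftP 0 j) => [j'|] -> /=;
  rewrite ?ord1; congr (g _ _); exact: val_inj.
Qed.

Lemma mulmx2E (K : pzRingType) (A B : 'M[K]_2) i j :
  (A *m B) i j = A i 0 * B 0 j + A i 1 * B 1 j.
Proof.
rewrite mxE !big_ord_recl big_ord0 addr0.
by congr (_ + A i _ * B _ j); exact: val_inj.
Qed.

Lemma mx2E (a b c d : int) :
  (mx2 a b c d 0 0 = a) * (mx2 a b c d 0 1 = b) *
  (mx2 a b c d 1 0 = c) * (mx2 a b c d 1 1 = d).
Proof. by rewrite !mxE. Qed.

Lemma mx2_mul (a b c d a' b' c' d' : int) : mx2 a b c d *m mx2 a' b' c' d' =
  mx2 (a * a' + b * c') (a * b' + b * d') (c * a' + d * c') (c * b' + d * d').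
Proof. by rewrite [LHS]mx2_eta !mulmx2E !mx2E. Qed.

Lemma det_mx2 (g : 'M[int]_2) : \det g = g 0 0 * g 1 1 - g 0 1 * g 1 0.
Proof.
rewrite (expand_det_row _ 0) !big_ord_recl big_ord0 addr0 /cofactor !det_mx11 !mxE /=.
have -> : lift 0 0 = 1 :> 'I_2 by exact: val_inj.
have -> : lift 1 0 = 0 :> 'I_2 by exact: val_inj.
rewrite /= !expr0 expr1; ring.
Qed.

Lemma SL2Z_mul g h : SL2Z g -> SL2Z h -> SL2Z (g *m h).
Proof. by rewrite /SL2Z /= det_mulmx => -> ->. Qed.

Lemma SL2Z_mx2 (a b c d : int) : a * d - b * c = 1 -> SL2Z (mx2 a b c d).
Proof. by rewrite /SL2Z /= det_mx2 !mx2E. Qed.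

Variable P : 'M[int]_2 -> Prop.
Hypotheses (PT : P matT) (PT' : P (mx2 1 (-1) 0 1)) (PS : P matS).
Hypothesis Pmul : forall g h, SL2Z g -> SL2Z h -> P g -> P h -> P (g *m h).

Let SL2Z_T n : SL2Z (mx2 1 n 0 1).
Proof. by apply: SL2Z_mx2; ring. Qed.

Let SL2Z_S : SL2Z matS.
Proof. by apply: SL2Z_mx2. Qed.

(** [P] is closed under products only, so negative powers take the inverse of T as a further
    generator. *)
Lemma translation_ind (n : int) : P (mx2 1 n 0 1).
Proof.
have Pnat m : P (mx2 1 m%:Z 0 1) /\ P (mx2 1 (- m%:Z) 0 1).
  elim: m => [|m [ih1 ih2]].
    have e : mx2 1 0 0 1 = matT *m mx2 1 (-1) 0 1 by rewrite mx2_mul; congr mx2; ring.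
    have P0 : P (mx2 1 0 0 1) by rewrite e; apply: Pmul => //; exact: SL2Z_T.
    by rewrite oppr0.
  split.
    have -> : mx2 1 m.+1%:Z 0 1 = mx2 1 m%:Z 0 1 *m matT by rewrite mx2_mul; congr mx2; lia.
    by apply: Pmul => //; exact: SL2Z_T.
  have -> : mx2 1 (- m.+1%:Z) 0 1 = mx2 1 (- m%:Z) 0 1 *m mx2 1 (-1) 0 1.
    by rewrite mx2_mul; congr mx2; lia.
  by apply: Pmul => //; exact: SL2Z_T.
case: n => m; first by have [] := Pnat m.
by rewrite NegzE; have [] := Pnat m.+1.
Qed.

(* Euclid's algorithm on the first column. *)
Lemma SL2Z_ind g : SL2Z g -> P g.
Proof.
have [n] := ubnP (absz (g 1%R 0%R)); elim: n g => // n IH g gn SLg.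
have dg : g 0 0 * g 1 1 - g 0 1 * g 1 0 = 1 by rewrite -det_mx2.
have [c0|c0] := eqVneq (g 1 0) 0.
  have ad : g 0 0 * g 1 1 = 1 by rewrite c0 mulr0 subr0 in dg.
  have : (g 0 0 = 1 /\ g 1 1 = 1) \/ (g 0 0 = -1 /\ g 1 1 = -1).
    move: (g 0 0) (g 1 1) ad => a d ad.
    have /eqP : (absz a * absz d)%N = 1%N by rewrite -abszM ad.
    by rewrite muln_eq1 => /andP[/eqP a1 /eqP d1]; case: a a1 ad => [] [|[|?]]//; case: d d1 => [] [|[|?]]//; [left|right].
  case=> -[a1 d1]; rewrite (mx2_eta g) a1 d1 c0; first exact: translation_ind.
  (* The sign is supplied by S^2 = -1. *)
  have -> : mx2 (-1) (g 0 1) 0 (-1) = (matS *m matS) *m mx2 1 (- g 0 1) 0 1.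
    by rewrite !mx2_mul; congr mx2; ring.
  apply: Pmul => //; [exact: SL2Z_mul|exact: Pmul|exact: translation_ind].
pose q := divz (g 0 0) (g 1 0); pose r := modz (g 0 0) (g 1 0).
have aE : g 0 0 = q * g 1 0 + r by exact: divz_eq.
have r0 : 0 <= r by exact: modz_ge0.
have r1 : r < `|g 1 0| by exact: ltz_mod.
(* h = S^(-1) T^(-q) g, whose lower left entry - r is smaller in absolute value than that of g. *)
pose h := mx2 (g 1 0) (g 1 1) (- r) (- (g 0 1 - q * g 1 1)).
have SLh : SL2Z h.
  apply: SL2Z_mx2; rewrite -[RHS]dg aE; ring.
have -> : g = mx2 1 q 0 1 *m (matS *m h).
  by rewrite /h !mx2_mul [LHS]mx2_eta; congr mx2; rewrite ?aE; ring.
have Ph : P h by apply: IH => //; rewrite /h mx2E; lia.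
apply: Pmul => //; [exact: SL2Z_mul|exact: translation_ind|exact: Pmul].
Qed.

End ModularGroup.

Section Moebius.
Variable R : realType.
Implicit Types (g h : 'M[int]_2) (tau : R[i]).

Lemma intr_complex (n : int) : n%:~R = (n%:~R : R)%:C :> R[i].
Proof. by rewrite rmorph_int. Qed.

Lemma autfactor_neq0 g tau : SL2Z g -> half_plane R tau -> autfactor g tau != 0.
Proof.
move=> SLg tau0; apply/negP => /eqP; rewrite /autfactor !intr_complex => e.
have := congr1 (@complex.Im R) e; rewrite ImD ImM !Re_real !Im_real mul0r !addr0.
move=> /eqP; rewrite mulf_eq0 (gt_eqF tau0) orbF intr_eq0 => /eqP c0.
have := congr1 (@complex.Re R) e; rewrite c0 mulr0z ReD ReM !Re_real !Im_real !mul0r subr0 add0r.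
move=> /eqP; rewrite intr_eq0 => /eqP d0.
by move: SLg; rewrite /SL2Z /= det_mx2 c0 d0 !mulr0 subr0.
Qed.

Lemma moebiusK g tau : autfactor g tau != 0 ->
  moebius g tau * autfactor g tau = (g 0 0)%:~R * tau + (g 0 1)%:~R.
Proof. by move=> j0; rewrite /moebius divfK. Qed.

Lemma half_plane_moebius g tau : SL2Z g -> half_plane R tau -> half_plane R (moebius g tau).
Proof.
move=> SLg tau0; have j0 := autfactor_neq0 SLg tau0.
have n0 : 0 < nc (autfactor g tau) ^+ 2 by rewrite exprn_gt0// normc_gt0.
suff -> : half_plane R (moebius g tau) = (0 < complex.Im tau / nc (autfactor g tau) ^+ 2).
  by rewrite divr_gt0.
rewrite /half_plane /=; congr (is_true (0 < _)).
have dg : (g 0 0)%:~R * (g 1 1)%:~R - (g 0 1)%:~R * (g 1 0)%:~R = 1 :> R.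
  by rewrite -!intrM -intrB -det_mx2 SLg.
apply: (mulIf (lt0r_neq0 n0)); rewrite divfK ?lt0r_neq0//.
have mE := moebiusK j0.
move: (moebius g tau) mE => m mE.
have e1 := congr1 (@complex.Re R) mE; have e2 := congr1 (@complex.Im R) mE.
move: e1 e2; rewrite normc_sqr !ReM !ImM /autfactor !intr_complex !ReImE !mul0r !subr0 !addr0.
move: (complex.Re m) (complex.Im m) (complex.Re tau) (complex.Im tau) dg => mr mi x y.
move: (g 0 0)%:~R (g 0 1)%:~R (g 1 0)%:~R (g 1 1)%:~R => a b c d dg e1 e2.
(* The parts [e1], [e2] of (g tau)(c tau + d) = a tau + b give Im (g tau) |c tau + d|^2 = (ad - bc)
   Im tau. *)
have -> : mi * ((c * x + d) ^+ 2 + (c * y) ^+ 2) =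
   (mr * (c * y) + mi * (c * x + d)) * (c * x + d) -
   (mr * (c * x + d) - mi * (c * y)) * (c * y) by ring.
rewrite e1 e2 -[RHS]mulr1 -dg; ring.
Qed.

Lemma moebius_mul g h tau : SL2Z g -> SL2Z h -> half_plane R tau ->
  moebius (g *m h) tau = moebius g (moebius h tau).
Proof.
move=> SLg SLh tau0; have j1 := autfactor_neq0 SLh tau0.
have j2 := autfactor_neq0 SLg (half_plane_moebius SLh tau0).
have j3 := autfactor_neq0 (SL2Z_mul SLg SLh) tau0.
have e : autfactor g (moebius h tau) * autfactor h tau = autfactor (g *m h) tau.
  rewrite {1}/autfactor mulrDl -mulrA moebiusK//.
  by rewrite /autfactor !mulmx2E !rmorphD !rmorphM/=; ring.
apply: (mulIf j3); rewrite moebiusK// -e mulrA moebiusK// mulrDl -mulrA moebiusK//.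
by rewrite /autfactor !mulmx2E !rmorphD !rmorphM/=; ring.
Qed.

Lemma autfactor1 tau : autfactor 1%:M tau = 1.
Proof. by rewrite /autfactor !mxE/= mul0r add0r. Qed.

Lemma moebius1 tau : moebius 1%:M tau = tau.
Proof. by rewrite /moebius autfactor1 !mxE/= mul1r addr0 divr1. Qed.

End Moebius.

(** * Complex powers *)

Section ComplexPowers.
Variable R : realType.
Implicit Types (z w tau : R[i]) (r : R).

(** The principal logarithm. *)
Definition clog z : R[i] := ln (nc z) +i* carg z.

Lemma cpowE z r : z != 0 -> cpow z r = cexp (r%:C * clog z).
Proof.
move=> z0; rewrite /cpow /cexp /clog ReM ImM !ReImE !mul0r subr0 addr0.
by rewrite /powR normc_eq0 (negbTE z0).
Qed.

Lemma cpow_neq0 z r : z != 0 -> cpow z r != 0.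
Proof. by move=> z0; rewrite cpowE// cexp_neq0. Qed.

Lemma cpowN z r : z != 0 -> cpow z (- r) = (cpow z r)^-1.
Proof. by move=> z0; rewrite !cpowE// rmorphN mulNr cexpN. Qed.

Lemma cpow1 r : cpow (1 : R[i]) r = 1.
Proof.
have e : clog (1 : R[i]) = 0.
  by rewrite /clog /carg /= expr1n expr0n addr0 sqrtr1 lexx divr1 acos1 ln1.
by rewrite cpowE ?oner_neq0// e mulr0 cexp0.
Qed.

Lemma Re_cexp w : complex.Re (cexp w) = expR (complex.Re w) * cos (complex.Im w).
Proof. by rewrite /cexp !ReImE mul0r subr0. Qed.

Lemma Im_cexp w : complex.Im (cexp w) = expR (complex.Re w) * sin (complex.Im w).
Proof. by rewrite /cexp !ReImE mul0r addr0. Qed.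

Lemma half_plane_cexp w : 0 < complex.Im w < pi -> half_plane R (cexp w).
Proof.
move=> wpi; suff : 0 < complex.Im (cexp w) by [].
by rewrite Im_cexp mulr_gt0 ?expR_gt0// sin_gt0_pi.
Qed.

Lemma clog_cexp w : 0 < complex.Im w < pi -> clog (cexp w) = w.
Proof.
move=> wpi; have h : 0 < complex.Im (cexp w) := half_plane_cexp wpi.
apply: complex_ext; rewrite /clog ?Re_mk ?Im_mk.
  by rewrite normc_cexp expRK.
rewrite /carg (ltW h) normc_cexp Re_cexp mulrAC divff ?gt_eqF ?expR_gt0// mul1r cosK//.
by rewrite in_itv/=; case/andP: wpi => a b; rewrite !ltW.
Qed.

Lemma half_plane_neq0 tau : half_plane R tau -> tau != 0.
Proof. by rewrite /half_plane/=; apply: contraTneq => ->; rewrite /= ltxx. Qed.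

(** With [clog_cexp], exp is a bijection from the strip 0 < Im w < pi onto the half plane. Im tau >
    0 selects the branch of [carg] and gives sin (acos x) = Im tau/|tau|. *)
Lemma clogK tau : half_plane R tau -> cexp (clog tau) = tau /\ 0 < complex.Im (clog tau) < pi.
Proof.
move=> h; have t0 := half_plane_neq0 h; have n0 : 0 < nc tau by rewrite normc_gt0.
have cE : carg tau = acos (complex.Re tau / nc tau) by rewrite /carg (ltW h).
pose x := complex.Re tau / nc tau.
have xE : 1 - x ^+ 2 = (complex.Im tau / nc tau) ^+ 2.
  rewrite /x !expr_div_n normc_sqr; field; rewrite -normc_sqr gt_eqF// exprn_gt0//.
have y0 : 0 < complex.Im tau / nc tau by rewrite divr_gt0.
have x2 : x ^+ 2 < 1 by rewrite -subr_gt0 xE exprn_gt0.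
have /andP[xl xr] : -1 < x < 1.
  by rewrite -ltr_norml -(@ltr_pXn2r _ 2) ?nnegrE// expr1n real_normK ?num_real.
have sE : sin (acos x) = complex.Im tau / nc tau.
  by rewrite sin_acos ?(ltW xl) ?(ltW xr)// xE sqrtr_sqr gtr0_norm.
split; last first.
  by rewrite /clog Im_mk cE -/x acos_gt0 ?acos_ltpi// ?xl ?xr ?(ltW xl) ?(ltW xr).
apply: complex_ext; rewrite ?Re_cexp ?Im_cexp /clog Re_mk Im_mk lnK ?posrE// cE -/x.
  by rewrite acosK ?in_itv/= ?(ltW xl) ?(ltW xr)// /x mulrCA divff ?mulr1// gt_eqF.
by rewrite sE mulrCA divff ?mulr1// gt_eqF.
Qed.

Lemma cpow_cexp w r : 0 < complex.Im w < pi -> cpow (cexp w) r = cexp (r%:C * w).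
Proof. by move=> wpi; rewrite cpowE ?cexp_neq0// clog_cexp. Qed.

Lemma pihalf_range : 0 < (pi / 2 : R) < pi.
Proof. by have := @pi_gt0 R; move=> p; apply/andP; split; lra. Qed.

Lemma cexp_pihalf (s : R) : cexp (s +i* (pi / 2)) = (expR s)*i.
Proof.
by apply: complex_ext; rewrite ?Re_cexp ?Im_cexp !Re_mk !Im_mk ?cos_pihalf ?sin_pihalf ?mulr0 ?mulr1.
Qed.

Lemma cpow_i r : cpow 'i r = cexp ((r * (pi / 2))*i) :> R[i].
Proof.
have {1}-> : 'i = cexp ((0 : R) +i* (pi / 2)) by rewrite cexp_pihalf expR0.
rewrite cpow_cexp; last exact: pihalf_range.
by congr cexp; apply: complex_ext; rewrite ?ReM ?ImM /=; ring.
Qed.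

Lemma cexp_2pi_int (n : int) : cexp (2 * pi * n%:~R)*i = 1 :> R[i].
Proof.
have Pnat l : cexp (2 * pi * l%:R)*i = 1 :> R[i].
  elim: l => [|l ih]; first by rewrite mulr0 -[0*i]/(0 : R[i]) cexp0.
  have -> : (2 * pi * l.+1%:R)*i = (2 * pi * l%:R)*i + (pi *+ 2)*i :> R[i].
    apply: complex_ext; rewrite ?ReD ?ImD ?Re_mk ?Im_mk ?addr0//.
    by rewrite -natr1 mulr2n; ring.
  rewrite cexpD ih mul1r; apply: complex_ext; rewrite ?Re_cexp ?Im_cexp Re_mk Im_mk expR0 mul1r.
    by rewrite cos2pi.
  by rewrite sin2pi.
case: n => l; first exact: Pnat.
have -> : (2 * pi * (Negz l)%:~R)*i = - (2 * pi * l.+1%:R)*i :> R[i].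
  by apply: complex_ext; rewrite ?ReN ?ImN ?Re_mk ?Im_mk ?oppr0// NegzE mulrNz mulrN.
by rewrite cexpN Pnat invr1.
Qed.

End ComplexPowers.

(** * The converse theorem *)

Section ConverseTheorem.
Variables (R : realType) (k : R) (chi : 'M[int]_2 -> R[i]) (m : nat).
Variables (rho : 'M[int]_2 -> 'M[R[i]]_m) (kappa : 'I_m -> R).
Variables (n0 : int) (a : 'I_m -> int -> R[i]).
Hypotheses (hchi : unitary_multiplier k chi) (hrho : unitary_representation rho).
Hypotheses (hkappa : exponents chi rho kappa) (ha : forall j, subexp_growth (a j)).

Local Notation D := (`]0, +oo[%classic : set R).
Local Notation f := (fourier_series kappa n0 a).

Definition fcoef j (l : nat) : R[i] := a j (shifted_index n0 l).
Definition fcomp j : R[i] -> R[i] := fourier_sum (fcoef j) (freq (kappa j) n0).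

Let sub j : subexp (fcoef j).
Proof. exact: subexp_growth_subexp. Qed.

Let frq j := freq_bound (kappa j) n0.

Lemma sum_std_basis (c : 'I_m -> R[i]) j : (\sum_i c i *: std_basis R i) j 0 = c j.
Proof.
rewrite summxE (bigD1 j)//= !mxE !eqxx mulr1 big1 ?addr0// => i ij.
by rewrite !mxE eq_sym (negbTE ij) mulr0.
Qed.

Lemma fourier_seriesE tau j : f tau j 0 = fcomp j tau.
Proof. by rewrite sum_std_basis. Qed.

Lemma fcomp_jet2 j tau : half_plane R tau -> jet2 (fcomp j) tau.
Proof. exact: jet2_fourier (sub j) (frq j). Qed.

Lemma chi_neq0 g : SL2Z g -> chi g != 0.
Proof.
move=> SLg; have := hchi.1 g SLg; apply: contra_eqN => /eqP ->.
by rewrite normr0 eq_sym oner_neq0.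
Qed.

(** The invariance under [slash] freed of inverses: in this form laws compose by the cocycle
    relation of [chi] and the multiplicativity of [rho]. *)
Definition modular g : Prop := forall tau, half_plane R tau ->
  f (moebius g tau) = (chi g * cpow (autfactor g tau) k) *: (rho g *m f tau).

Lemma modular_slash g : SL2Z g -> modular g -> forall tau, half_plane R tau ->
  slash k chi rho f g tau = f tau.
Proof.
move=> SLg mg tau h; have j0 := autfactor_neq0 SLg h.
rewrite /slash mg// -scalemxAr mulmxA mulVmx ?unitarymx_unit ?hrho.1// mul1mx scalerA.
have c0 := chi_neq0 SLg; have p0 := cpow_neq0 k j0.
rewrite cpowN// (_ : _ * _ = 1) ?scale1r//.
by field; rewrite c0 p0.
Qed.

Lemma modular_mul g h : SL2Z g -> SL2Z h -> modular g -> modular h -> modular (g *m h).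
Proof.
move=> SLg SLh mg mh tau ht.
rewrite moebius_mul// mg; last exact: half_plane_moebius.
rewrite mh// -scalemxAr mulmxA -hrho.2// scalerA; congr (_ *: _).
rewrite hchi.2//; ring.
Qed.

Lemma SL2Z1 : SL2Z 1%:M.
Proof. by rewrite /SL2Z/= det1. Qed.

Lemma half_plane_i : half_plane R 'i.
Proof. by rewrite /half_plane/= ltr01. Qed.

Lemma chi1 : chi 1%:M = 1.
Proof.
have := hchi.2 _ _ _ SL2Z1 SL2Z1 half_plane_i.
rewrite mulmx1 moebius1 !autfactor1 !cpow1 !mulr1 => e.
by apply: (mulfI (chi_neq0 SL2Z1)); rewrite -e mulr1.
Qed.

Lemma rho1 : rho 1%:M = 1%:M.
Proof.
have u := unitarymx_unit (hrho.1 _ SL2Z1).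
by have := hrho.2 _ _ SL2Z1 SL2Z1; rewrite mulmx1 => /(congr1 (mulmx (invmx (rho 1%:M))));
  rewrite mulmxA mulVmx// mul1mx => <-.
Qed.

(** Apply the law of g at h tau; the cocycle relation for g h = 1 makes the two scalar factors
    cancel. This supplies the inverse of T. *)
Lemma modular_inv g h : SL2Z g -> SL2Z h -> g *m h = 1%:M -> h *m g = 1%:M ->
  modular g -> modular h.
Proof.
move=> SLg SLh gh hg mg tau ht; have hh := half_plane_moebius SLh ht.
have := mg _ hh; rewrite -moebius_mul// gh moebius1 => ->.
rewrite -scalemxAr mulmxA -hrho.2// hg rho1 mul1mx scalerA.
have := hchi.2 _ _ _ SLg SLh ht; rewrite gh autfactor1 cpow1 chi1 mulr1 => e.
by rewrite (_ : _ * _ = 1) ?scale1r// e; ring.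
Qed.

Lemma matT_action (tau : R[i]) : moebius matT tau = tau + 1 /\ autfactor matT tau = 1.
Proof.
have e : autfactor matT tau = 1 by rewrite /autfactor !mx2E mul0r add0r.
by rewrite /moebius e !mx2E divr1 mul1r.
Qed.

Lemma fcomp_translation j tau : half_plane R tau ->
  fcomp j (tau + 1) = cexp (2 * pi * kappa j)*i * fcomp j tau.
Proof.
move=> ht; apply: csum_limn.
have := @csumZ _ (cexp (2 * pi * kappa j)*i) _ _ (fterm_csum (sub j) (frq j) ht).
congr csum; apply/funext => l; rewrite /fterm [_ * (tau + 1)]mulrDr cexpD mulr1 mulrCA; congr (_ * _).
rewrite mulrC; congr (_ * _); rewrite /freq.
set n := shifted_index n0 l.
have -> : (2 * pi * (n%:~R + kappa j))*i = (2 * pi * n%:~R)*i + (2 * pi * kappa j)*i :> R[i].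
  by apply: complex_ext; rewrite ?ReD ?ImD /=; ring.
by rewrite cexpD cexp_2pi_int mul1r.
Qed.

Lemma modular_T : modular matT.
Proof.
move=> tau ht; have [-> ->] := matT_action tau; rewrite cpow1 mulr1.
have -> : f tau = \sum_j fcomp j tau *: std_basis R j by [].
rewrite mulmx_sumr scaler_sumr; apply: eq_bigr => j _.
rewrite -scalemxAr scalerA mulrC -scalerA (hkappa j).2 scalerA; congr (_ *: _).
by rewrite mulrC; exact: fcomp_translation.
Qed.

(** * The law under S, on the imaginary axis and then on the half plane *)

Variable Sc : set (R -> R[i]).
Hypothesis hSc : forall phi, Sc phi -> compactly_supported phi /\ piecewise_smooth phi.
Hypothesis hSc_nz : forall y : R, 0 < y -> exists2 phi, Sc phi & phi y != 0.
Hypothesis hSc_mul : stable_mulX Sc.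
Hypothesis hfe : forall phi, Sc phi ->
  Lseries kappa n0 a phi =
  cpow 'i k *: (rho matS *m Lseries kappa n0 a (slashS k chi phi)).

Lemma Sc_mulXn phi j : Sc phi -> Sc (fun x => (x ^+ j)%:C * phi x).
Proof.
move=> Sphi; elim: j => [|j ih].
  rewrite (_ : (fun x => _) = phi)//; apply/funext => x.
  by rewrite expr0 rmorph1 mul1r.
have := hSc_mul ih; congr (Sc _); apply/funext => x.
by rewrite exprS rmorphM mulrA.
Qed.

Lemma Lseries_integral phi (al be M : R) j : 0 < al -> 0 < be -> tame al be M phi ->
  Lseries kappa n0 a phi j 0 = cintegral D (fun t => fcomp j t*i * phi t).
Proof.
move=> al0 be0 tphi; rewrite /Lseries sum_std_basis.
exact/csum_limn/(laplace_csum (sub j) (frq j) al0 be0 tphi).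
Qed.

(** For one [phi] with phi y != 0, all products x^n phi lie in [Sc], so [moment_derivative] applies
    at y; phi y is then cancelled. *)
Lemma imaginary_axis j (y : R) : 0 < y -> fcomp j y*i =
  (chi matS * (cpow 'i k * (y `^ (- k))%:C)) * \sum_l rho matS j l * fcomp l (y^-1)*i.
Proof.
move=> y0; have [phi Sphi phiy] := hSc_nz y0.
have [csp psp] := hSc Sphi.
have [al [be [M [al0 be0 tphi]]]] := piecewise_smooth_tame csp psp.
pose psi := slashS k chi phi.
have [M' tpsi] := slashS_tame k chi al0 be0 tphi.
have ial0 : 0 < al^-1 by rewrite invr_gt0.
have ibe0 : 0 < be^-1 by rewrite invr_gt0.
pose c l := cpow 'i k * rho matS j l.
pose G1 t := fcomp j t*i * phi t.
pose G2 t := \sum_(l <- enum 'I_m) c l * (fcomp l t*i * psi t).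
have [N1 tG1] := fourier_tame (sub j) (frq j) al0 be0 tphi.
have /choice[N HN] : forall l, exists N, tame be^-1 al^-1 N (fun t => fcomp l t*i * psi t).
  by move=> l; exact: (fourier_tame (sub l) (frq l) ibe0 ial0 tpsi).
have tZ l : tame be^-1 al^-1 (nc (c l) * N l) (fun t => c l * (fcomp l t*i * psi t)).
  by apply: tameM (HN l); [exact: normc_ge0|exact: cmeas_cst|].
have tG2 : tame be^-1 al^-1 _ G2 := tame_sum (enum 'I_m) tZ.
have moments n : cintegral D (fun t => (t ^+ n)%:C * G1 t) =
    cintegral D (fun t => (t^-1 ^+ n)%:C * G2 t).
  have Sn := Sc_mulXn n Sphi.
  have [csn psn] := hSc Sn.
  (* These bounds may differ from those of [phi]; they serve only to integrate termwise. *)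
  have [al' [be' [L [al0' be0' tn]]]] := piecewise_smooth_tame csn psn.
  have ial' : 0 < al'^-1 by rewrite invr_gt0.
  have ibe' : 0 < be'^-1 by rewrite invr_gt0.
  have [L' tn'] := slashS_tame k chi al0' be0' tn.
  have := congr1 (fun v : 'cV_m => v j 0) (hfe Sn).
  rewrite (Lseries_integral _ al0' be0' tn) !mxE.
  under [X in _ = _ * X]eq_bigr => l _ do rewrite (Lseries_integral _ ibe' ial' tn').
  move=> e; transitivity (cintegral D (fun t => fcomp j t*i * ((t ^+ n)%:C * phi t))).
    by apply: eq_cintegral => t _; rewrite /G1 mulrCA.
  rewrite e mulr_sumr -big_enum /=.
  (* The S-transform turns the factor x^n into x^(-n), hence the moments in 1/t on the right. *)
  have sE t : slashS k chi (fun x => (x ^+ n)%:C * phi x) t = (t^-1 ^+ n)%:C * psi t.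
    by rewrite /psi /slashS; ring.
  have /choice[Q HQ] : forall l, exists Q, tame be'^-1 al'^-1 Q
      (fun t => fcomp l t*i * slashS k chi (fun x => (x ^+ n)%:C * phi x) t).
    by move=> l; exact: (fourier_tame (sub l) (frq l) ibe' ial' tn').
  have tZ' l : tame be'^-1 al'^-1 (nc (c l) * Q l) (fun t => c l *
      (fcomp l t*i * slashS k chi (fun x => (x ^+ n)%:C * phi x) t)).
    by apply: tameM (HQ l); [exact: normc_ge0|exact: cmeas_cst|].
  transitivity (\sum_(l <- enum 'I_m) cintegral D (fun t => c l *
      (fcomp l t*i * slashS k chi (fun x => (x ^+ n)%:C * phi x) t))).
    by apply: eq_bigr => l _; rewrite (cintegralZ _ (HQ l)) mulrA.
  rewrite -(cintegral_sum _ tZ'); apply: eq_cintegral => t _.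
  by rewrite /G2 mulr_sumr; apply: eq_bigr => l _; rewrite sE; ring.
have [I [g [d [sg d0 phig Ig side]]]] := piecewise_smooth_germ psp y0.
have yi : half_plane R y*i by [].
have yi' : half_plane R (y^-1)*i by rewrite /half_plane/= invr_gt0.
(* With the smooth piece [g] in place of [phi], [G1'] and [G2'] are continuous at y; on [I] they
   agree with G1(t) and G2(1/t). *)
pose G1' t := fcomp j t*i * g t.
pose G2' t := \sum_(l <- enum 'I_m) c l * (fcomp l (t^-1)*i *
  (((t^-1) `^ (k - 2))%:C * chi matS * g t)).
have cinv : {for y, continuous (fun t : R => t^-1)} by apply: inv_continuous; rewrite gt_eqF.
have c1 : ccont G1' y.
  apply: ccontM; last exact: smooth_ccont.
  by apply: ccont_jet2; [apply: ccont_imag; exact: cvg_id|exact: fcomp_jet2].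
have c2 : ccont G2' y.
  apply: ccont_sum => l; apply: ccontM; first exact: ccont_cst.
  apply: ccontM; first by apply: ccont_jet2; [exact: ccont_imag|exact: fcomp_jet2].
  apply: ccontM; last exact: smooth_ccont.
  apply: ccontM; last exact: ccont_cst.
  apply: ccont_real; apply: (@continuous_comp _ _ _ (fun t : R => t^-1) (fun t => t `^ (k - 2))) => //.
  by apply: powR_continuous; rewrite invr_gt0.
have E1 t : phi t = g t -> G1 t = G1' t by rewrite /G1 /G1' => ->.
have E2 t : phi t = g t -> G2 t^-1 = G2' t.
  by move=> e; rewrite /G2 /G2'; apply: eq_bigr => l _; rewrite /psi /slashS invrK e.
have H (e : R) : 0 < e -> exists2 d : R, 0 < d & forall t, 0 < t -> I t -> `|t - y| < d ->
     nc (G1 t - G1 y) <= e /\ nc (G2 t^-1 - G2 y^-1) <= e.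
  move=> e0; have [d1 d10 H1] := ccontP c1 e0; have [d2 d20 H2] := ccontP c2 e0.
  exists (Num.min d1 d2); first by rewrite lt_min d10.
  move=> t t0 It; rewrite lt_min => /andP[t1 t2].
  rewrite (E1 t (Ig t It)) (E1 y phig) (E2 t (Ig t It)) (E2 y phig).
  by split; [exact: H1|exact: H2].
have := moment_derivative al0 be0 tG1 tG2 moments y0 d0 side H.
rewrite /G1 /G2 => e; apply: (mulIf phiy); rewrite e.
rewrite big_enum/= !mulr_sumr mulr_suml; apply: eq_bigr => l _.
rewrite /c /psi /slashS invrK.
(* The Jacobian y^(-2) and the factor (1/y)^(k-2) of the S-transform combine to the weight. *)
have -> : y `^ (- k) = y^-1 ^+ 2 * (y^-1) `^ (k - 2).
  rewrite -[- k]mulN1r powRrM powR_inv1 ?(ltW y0)// -powR_mulrn ?invr_ge0 ?(ltW y0)// -powRD.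
    by rewrite addrC subrK.
  by apply/implyP => _; rewrite invr_eq0 gt_eqF.
rewrite rmorphM; ring.
Qed.

(** Component j of f(-1/tau) - chi(S) tau^k rho(S) f(tau) at tau = exp w, with tau^k written as exp
    (k w). *)
Definition defect j w : R[i] :=
  fcomp j (- cexp (- w)) - chi matS * cexp (k%:C * w) * \sum_l rho matS j l * fcomp l (cexp w).

Lemma half_plane_cexpN w : 0 < complex.Im w < pi -> half_plane R (- cexp (- w)).
Proof.
move=> wpi; suff : 0 < complex.Im (- cexp (- w)) by [].
rewrite ImN Im_cexp ImN sinN mulrN opprK.
by rewrite mulr_gt0 ?expR_gt0// sin_gt0_pi.
Qed.

Lemma defect0 j w : 0 < complex.Im w < pi -> defect j w = 0.
Proof.
(* Shifting by i pi/2 moves the imaginary axis to the real line and the half plane to the strip |Im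
   z| < pi/2; pi/2 <= 2 meets the width condition of [strip_identity]. *)
move=> wpi; pose s0 : R[i] := (pi / 2)*i.
have V2 : pi / 2 <= 2 :> R by exact/ltW/pihalf_lt2.
have shift z : `|complex.Im z| < pi / 2 -> 0 < complex.Im (z + s0) < pi.
  by rewrite ImD Im_mk ltr_norml => /andP[b c]; apply/andP; split; lra.
have -> : w = (w - s0) + s0 by rewrite subrK.
apply: (@strip_identity _ (fun z => defect j (z + s0)) _ V2).
- move=> z /shift zpi.
  have jid : jet2 (fun z : R[i] => z + s0) z by apply: jet2D; [exact: jet2_id|exact: jet2_cst].
  have jexp (u : R[i]) : jet2 (fun z => cexp (u * (z + s0))) z.
    apply: (@jet2_comp _ (@cexp R)); last exact: jet2_cexp.
    by apply: jet2M => //; exact: jet2_cst.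
  have jN : jet2 (fun z => (-1) * cexp ((-1) * (z + s0))) z.
    by apply: jet2M; [exact: jet2_cst|exact: jexp].
  (* Signs are written as factors -1, and a factor 1 is inserted, to match [jexp] and the closure of
     jets under products. *)
  rewrite (_ : (fun z => defect j (z + s0)) = fun z => fcomp j ((-1) * cexp ((-1) * (z + s0))) +
     ((- chi matS) * cexp (k%:C * (z + s0))) *
     \sum_(l <- enum 'I_m) rho matS j l * fcomp l (cexp (1 * (z + s0)))); last first.
    by apply/funext => u; rewrite /defect !mulN1r big_enum/= !mulNr; under [in RHS]eq_bigr do rewrite mul1r.
  apply: jet2D.
    apply: (@jet2_comp _ (fcomp j)) => //; apply: fcomp_jet2.
    by rewrite !mulN1r; exact: half_plane_cexpN.
  apply: jet2M; first by apply: jet2M; [exact: jet2_cst|exact: jexp].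
  apply: jet2_sum => l; apply: jet2M; first exact: jet2_cst.
  apply: (@jet2_comp _ (fcomp l)); first exact: jexp.
  by apply: fcomp_jet2; rewrite mul1r; exact: half_plane_cexp.
- move=> s; rewrite /defect.
  have -> : s%:C + s0 = s +i* (pi / 2) by apply: complex_ext; rewrite ?ReD ?ImD /=; ring.
  have -> : - cexp (- (s +i* (pi / 2))) = (expR (- s))*i.
    rewrite cexpN cexp_pihalf expRN; apply: (mulIf (x := (expR s)*i)).
      by rewrite -normc_gt0/= expr0n add0r sqrtr_sqr normr_gt0 gt_eqF// expR_gt0.
    rewrite mulNr mulVf; last first.
      by rewrite -normc_gt0/= expr0n add0r sqrtr_sqr normr_gt0 gt_eqF// expR_gt0.
    apply: complex_ext; rewrite ?ReM ?ImM ?ReN ?ImN /=; last by ring.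
    by rewrite mul0r sub0r mulVf// gt_eqF// expR_gt0.
  (* The law on the axis is used at y = exp (- s): y^(-k) = exp (k s), and i^k exp (k s) = exp (k (s
     + i pi/2)). *)
  rewrite cexp_pihalf imaginary_axis ?expR_gt0// cpow_i expRN invrK.
  apply/eqP; rewrite subr_eq0; apply/eqP; congr (_ * _ * _).
  have -> : (expR s)^-1 `^ (- k) = expR (k * s).
    by rewrite -expRN /powR gt_eqF ?expR_gt0// expRK mulrNN.
  apply: complex_ext.
    by rewrite ReM Re_cexp Im_cexp Re_cexp !ReImE !mul0r !mulr0 expR0; rewrite ?subr0 ?addr0; ring.
  by rewrite ImM Re_cexp Im_cexp Im_cexp !ReImE !mul0r !mulr0 expR0; rewrite ?subr0 ?addr0; ring.
- by rewrite ImD ImN Im_mk ltr_norml; move: wpi => /andP[b c]; apply/andP; split; lra.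
Qed.

Lemma modular_S : modular matS.
Proof.
move=> tau ht; have [tE wpi] := clogK ht.
have aS : autfactor matS tau = tau by rewrite /autfactor !mx2E mul1r addr0.
have mS : moebius matS tau = - cexp (- clog tau).
  by rewrite /moebius aS !mx2E mul0r add0r mulrN1z mulN1r cexpN tE.
rewrite aS mS; apply/matrixP => j i; rewrite ord1 fourier_seriesE !mxE.
under eq_bigr do rewrite fourier_seriesE.
have /eqP := defect0 j wpi; rewrite /defect subr_eq0 tE => /eqP ->.
by rewrite -{3}tE cpow_cexp.
Qed.

Lemma modular_all g : SL2Z g -> modular g.
Proof.
apply: SL2Z_ind => //; [exact: modular_T| |exact: modular_S|exact: modular_mul].
have e1 : mx2 1 0 0 1 = 1%:M by rewrite [RHS]mx2_eta !mxE.
apply: (@modular_inv matT) modular_T; try exact: SL2Z_mx2.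
- by rewrite mx2_mul -e1; congr mx2; ring.
- by rewrite mx2_mul -e1; congr mx2; ring.
Qed.

End ConverseTheorem.

Unset Implicit Arguments.

Theorem theorem2p3 (R : realType) (k : R) (hk : half_integer k)
    (chi : 'M[int]_2 -> R[i]) (hchi : unitary_multiplier k chi)
    (m : nat) (hm : (1 <= m)%N)
    (rho : 'M[int]_2 -> 'M[R[i]]_m) (hrho : unitary_representation rho)
    (kappa : 'I_m -> R) (hkappa : exponents chi rho kappa)
    (Sc : set (R -> R[i]))
    (hSc : forall phi, Sc phi -> compactly_supported phi /\ piecewise_smooth phi)
    (hSc_nz : forall y : R, 0 < y -> exists2 phi, Sc phi & phi y != 0)
    (hSc_mul : stable_mulX Sc)
    (n0 : int) (a : 'I_m -> int -> R[i])
    (ha : forall j, subexp_growth (a j))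
    (hfe : forall phi, Sc phi ->
       Lseries kappa n0 a phi =
       cpow 'i k *: (rho matS *m Lseries kappa n0 a (slashS k chi phi))) :
  weakly_holomorphic_forms k chi rho kappa (fourier_series kappa n0 a).
Proof.
split.
- move=> j tau htau; apply: jet2_derivable.
  rewrite (_ : (fun _ => _) = fcomp kappa n0 a j); first exact: fcomp_jet2.
  by apply/funext => z; exact: fourier_seriesE.
- move=> g SLg tau htau; apply: modular_slash => //.
  exact: (modular_all hchi hrho hkappa ha hSc hSc_nz hSc_mul hfe).
- move=> j; exists n0, (a j) => tau htau; rewrite fourier_seriesE.
  exact: fterm_csum (subexp_growth_subexp n0 (ha j)) (freq_bound (kappa j) n0) htau.
Qed.
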